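(* Let $m$ be a string transduction and $k\ge1$. If $m\in\mathcal{NGSM}^k$ and $m$ is finitary, then $m\in\mathcal{MREL}\circ\mathcal{DGSM}$.
   Context: A 2gsm is $M=(Q,\Sigma_1,\Sigma_2,\delta,q_{in},q_f)$ with finite state set $Q$ and instructions $(p,\sigma,q_1,\alpha_1,\epsilon_1,q_0,\alpha_0,\epsilon_0)$, $p\neq q_f$, $\sigma\in\Sigma_1\cup\{\vdash,\dashv\}$, $\alpha_i\in\Sigma_2^*$, $\epsilon_i\in\{-1,0,+1\}$. On input $w$ the read-only tape is $\vdash w\dashv$ (positions $0..|w|+1$); start in $q_{in}$ at position 0; in state $p$ any instruction starting with $p$ may be executed: if the scanned symbol is $\sigma$, go to $q_1$, append $\alpha_1$ to the one-way output tape and move by $\epsilon_1$, else do the same with $(q_0,\alpha_0,\epsilon_0)$; the head may not leave the tape. $M$ realizes the relation of all $(w,z)$ such that some computation reaches $q_f$ having written $z$. $M$ is deterministic if each state has at most one instruction. $\mathcal{NGSM}$ / $\mathcal{DGSM}$: transductions realized by 2gsm's / deterministic 2gsm's; $\mathcal{NGSM}^k$ is the family of compositions of $k$ transductions from $\mathcal{NGSM}$. A string relabelling given by $R\subseteq\Delta_1\times\Delta_2$ maps $\sigma_1\cdots\sigma_n$ to all $\tau_1\cdots\tau_n$ with $\tau_i\in R(\sigma_i)$. A marked string relabelling maps $w$ to $\vdash w\dashv$ and then applies a string relabelling; $\mathcal{MREL}$ is their family. A relation $m$ is finitary if $\{z\mid(w,z)\in m\}$ is finite for each $w$ in its domain.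 Composition: $R_1\circ R_2=\{(a,c)\mid\exists b:(a,b)\in R_1,(b,c)\in R_2\}$, extended to families elementwise. *)

(* Defs.v *)
From Stdlib Require List.
From mathcomp Require Import all_boot.
Set Implicit Arguments.
Unset Strict Implicit.
Unset Printing Implicit Defensive.

(* Tape symbols: input letters plus the end markers |- and -| *)
Inductive sym (A : Type) : Type := LM | RM | Sy of A.
Arguments LM {A}. Arguments RM {A}.

(* |- w -| : positions 0 .. |w|+1 *)
Definition marked (A : Type) (w : seq A) : seq (sym A) :=
  LM :: map (@Sy A) w ++ [:: RM].

Inductive dir := Lft | Stay | Rgt.

Definition move (d : dir) (i : nat) : option nat :=
  match d with
  | Lft => if i is j.+1 then Some j else None
  | Stay => Some i
  | Rgt => Some i.+1
  end.

Record instr (Q A B : Type) := Instr {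
  ip : Q; isig : sym A;
  iq1 : Q; ia1 : seq B; ie1 : dir;
  iq0 : Q; ia0 : seq B; ie0 : dir }.

Record gsm (A B : finType) := Gsm {
  gQ : finType;
  gdelta : seq (instr gQ A B);
  gqin : gQ;
  gqf : gQ;
  gwf : forall t, List.In t gdelta -> ip t <> gqf }.

Definition deterministic (A B : finType) (M : gsm A B) : Prop :=
  forall t1 t2, List.In t1 (gdelta M) -> List.In t2 (gdelta M) ->
    ip t1 = ip t2 -> t1 = t2.

(* configurations: state, head position, output written so far *)
Definition conf (A B : finType) (M : gsm A B) := (gQ M * nat * seq B)%type.

Definition step (A B : finType) (M : gsm A B) (w : seq A)
    (c c' : conf M) : Prop :=
  let: (p, i, z) := c in
  let: (q, j, z') := c' in
  exists t, List.In t (gdelta M) /\ ip t = p /\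
    j < size (marked w) /\
    let s := nth LM (marked w) i in
    ((s = isig t /\ q = iq1 t /\ z' = z ++ ia1 t /\ move (ie1 t) i = Some j)
     \/
     (s <> isig t /\ q = iq0 t /\ z' = z ++ ia0 t /\ move (ie0 t) i = Some j)).

Inductive reach (A B : finType) (M : gsm A B) (w : seq A) :
    conf M -> conf M -> Prop :=
  | reach_refl c : @reach A B M w c c
  | reach_step c1 c2 c3 : @step A B M w c1 c2 -> @reach A B M w c2 c3 -> @reach A B M w c1 c3.

Definition realized (A B : finType) (M : gsm A B) (w : seq A) (z : seq B) : Prop :=
  exists i, @reach A B M w (gqin M, 0, [::]) (gqf M, i, z).

Definition transduction (A B : Type) := seq A -> seq B -> Prop.

Definition comp (A B C : Type) (m1 : transduction A B) (m2 : transduction B C)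
  : transduction A C := fun a c => exists b, m1 a b /\ m2 b c.

Definition in_NGSM (A B : finType) (m : transduction A B) : Prop :=
  exists M : gsm A B, forall w z, m w z <-> realized M w z.

Definition in_DGSM (A B : finType) (m : transduction A B) : Prop :=
  exists M : gsm A B, deterministic M /\ forall w z, m w z <-> realized M w z.

(* NGSM^k, k >= 1 ; in_NGSMk k is NGSM^(k+1) *)
Fixpoint in_NGSMk (k : nat) (A B : finType) (m : transduction A B) : Prop :=
  match k with
  | 0 => in_NGSM m
  | k'.+1 => exists (C : finType) (m1 : transduction A C) (m2 : transduction C B),
      in_NGSM m1 /\ in_NGSMk k' m2 /\ forall w z, m w z <-> comp m1 m2 w z
  end.

Definition in_NGSM_pow (k : nat) (A B : finType) (m : transduction A B) : Prop :=
  in_NGSMk k.-1 m.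

Definition relabel (D1 D2 : Type) (R : D1 -> D2 -> bool) (u : seq D1) (v : seq D2)
  : Prop := all2 R u v.

Definition in_MREL (A D : finType) (m : transduction A D) : Prop :=
  exists R : sym A -> D -> bool, forall w z, m w z <-> relabel R (marked w) z.

Definition in_MREL_DGSM (A B : finType) (m : transduction A B) : Prop :=
  exists (D : finType) (m1 : transduction A D) (m2 : transduction D B),
    in_MREL m1 /\ in_DGSM m2 /\ forall w z, m w z <-> comp m1 m2 w z.

Definition finitary (A B : Type) (m : transduction A B) : Prop :=
  forall w, (exists z, m w z) -> exists s : seq (seq B), forall z, m w z -> List.In z s.

(* Main.v *)
From HB Require Import structures.
From mathcomp Require Import all_boot.
From mathcomp Require Import boolp zify.
Require Import Defs.
Set Implicit Arguments.
Unset Strict Implicit.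
Unset Printing Implicit Defensive.

(** Let n be a nondeterministic and d a deterministic two-way machine, and suppose
    that n followed by d has only finitely many outputs on w. Cut a run of n at its
    visits of one and the same configuration. If such a visit splits the intermediate
    word into a prefix and a suffix whose two-way behaviour for d is the same as at a
    later visit, then the part in between can be repeated at will, hence d cannot write
    anything there. If moreover it can be dropped from a longer such part without changing
    the behaviour of the latter, then dropping it does not change the output of d. There
    are finitely many behaviours, so it suffices to consider runs of n that visit every
    configuration a bounded number of times. Such a run can be guessed by relabelling the
    tape with pointers to the next and the previous visit; a deterministic machine checks
    the pointers and walks back and forth along the run to simulate d on the intermediate
    word. The theorem follows by induction on k, as a relabelling can be absorbed
    into n. *)

(** * Finiteness of tape symbols and head moves *)

Definition sym_code (A : Type) (s : sym A) : option (option A) :=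
  match s with LM => None | RM => Some None | Sy a => Some (Some a) end.
Definition sym_decode (A : Type) (x : option (option A)) : sym A :=
  match x with None => LM | Some None => RM | Some (Some a) => Sy a end.
Lemma sym_codeK (A : Type) : cancel (@sym_code A) (@sym_decode A).
Proof. by case. Qed.
HB.instance Definition _ (A : finType) := Finite.copy (sym A) (can_type (@sym_codeK A)).

Definition dir_code (e : dir) : option bool :=
  match e with Lft => Some true | Stay => None | Rgt => Some false end.
Definition dir_decode (x : option bool) : dir :=
  match x with Some true => Lft | None => Stay | Some false => Rgt end.
Lemma dir_codeK : cancel dir_code dir_decode.
Proof. by case. Qed.
HB.instance Definition _ := Finite.copy dir (can_type dir_codeK).


Arguments marked {A} w : simpl never.

(** A total version of [move] for positions counted from 1: the scanned position is positive, so the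
    truncated predecessor is exact, and reaching 0 means falling off on the left. *)
Definition mv (e : dir) (i : nat) : nat :=
  match e with Lft => i.-1 | Stay => i | Rgt => i.+1 end.

(** * Runs on tape segments *)

Section Runs.
Variables (Q C O : Type) (stp : Q -> sym C -> Q -> seq O -> dir -> Prop).
Implicit Types (S : seq (sym C)) (c : Q * nat) (tr : seq (Q * nat * seq O)).

Definition cell S i := nth LM S i.-1.

(* Positions on a tape segment are numbered from 1, so that 0 and [(size S).+1]
   stand for having left the segment on either side. *)
Inductive srun S : Q * nat -> seq (Q * nat * seq O) -> Q * nat -> Prop :=
| srun0 c : srun S c [::] c
| srunS p i q o e tr c : 0 < i <= size S -> stp p (cell S i) q o e ->
    srun S (q, mv e i) tr c -> srun S (p, i) ((p, i, o) :: tr) c.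

Definition outs tr := flatten [seq x.2 | x <- tr].

Definition accepts (q0 qf : Q) S tr :=
  exists2 i, 0 < i <= size S & srun S (q0, 1) tr (qf, i).

Lemma outs_cat tr1 tr2 : outs (tr1 ++ tr2) = outs tr1 ++ outs tr2.
Proof. by rewrite /outs map_cat flatten_cat. Qed.

Lemma srun_cat S c1 tr1 c2 tr2 c3 :
  srun S c1 tr1 c2 -> srun S c2 tr2 c3 -> srun S c1 (tr1 ++ tr2) c3.
Proof.
elim=> {c1 tr1 c2} // p i q o e tr c ib st _ IH r2.
by apply: srunS ib st (IH r2).
Qed.

Lemma srun_split S c1 tr1 tr2 c3 : srun S c1 (tr1 ++ tr2) c3 ->
  exists2 c2, srun S c1 tr1 c2 & srun S c2 tr2 c3.
Proof.
elim: tr1 c1 => [|x tr1 IH] c1 /=; first by exists c1 => //; exact: srun0.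
move=> H; inversion H; subst.
have [c2 r1 r2] := IH _ H6; exists c2 => //; exact: srunS r1.
Qed.

Lemma srun_head S c1 x o tr c2 : srun S c1 ((x, o) :: tr) c2 -> c1 = x.
Proof. by move=> H; inversion H; subst. Qed.

Lemma srun_pos S c1 tr c2 : srun S c1 tr c2 ->
  forall x, List.In x tr -> 0 < x.1.2 <= size S.
Proof. by elim=> {c1 tr c2} // p i q o e tr c ib _ _ IH x /= [<-//|/IH]. Qed.

Lemma cell_catl S1 S2 i : 0 < i <= size S1 -> cell (S1 ++ S2) i = cell S1 i.
Proof. by move=> ib; rewrite /cell nth_cat ifT //; lia. Qed.

Lemma cell_catr S1 S2 i : 0 < i -> cell (S1 ++ S2) (size S1 + i) = cell S2 i.
Proof.
move=> ib; rewrite /cell nth_cat ifF; last lia.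
by congr nth; lia.
Qed.

Definition shift k tr := [seq (x.1.1, k + x.1.2, x.2) | x <- tr].

Lemma outs_shift k tr : outs (shift k tr) = outs tr.
Proof. by rewrite /outs /shift -map_comp. Qed.

Lemma srun_embed X V Y c1 tr c2 : srun V c1 tr c2 ->
  srun (X ++ V ++ Y) (c1.1, size X + c1.2) (shift (size X) tr) (c2.1, size X + c2.2).
Proof.
elim=> {c1 tr c2} [c|p i q o e tr c ib st _ IH] /=; first exact: srun0.
apply: (@srunS _ _ _ q _ e); first by rewrite !size_cat; lia.
- rewrite cell_catr; last by lia.
  by rewrite cell_catl.
- by have -> : mv e (size X + i) = size X + mv e i by case: (e) => /=; lia.
Qed.

Lemma srun_nth S c1 tr c2 d : srun S c1 tr c2 ->
  let conf := nth d (rcons (map fst tr) c2) in conf 0 = c1 /\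
  forall t, t < size tr -> exists e, [/\ 0 < (conf t).2 <= size S,
    stp (conf t).1 (cell S (conf t).2) (conf t.+1).1 (nth [::] (map snd tr) t) e
    & mv e (conf t).2 = (conf t.+1).2].
Proof.
elim=> {c1 tr c2} //= p i q o e tr c ib st r [IH0 IH]; split=> // -[_|t lt]; last exact: IH.
by exists e; rewrite IH0.
Qed.

End Runs.
Arguments srun0 {Q C O stp S c}.

(** * Two-way behaviour of a segment *)

Section Behaviour.
Variables (Q : finType) (C O : Type).
Variables (stp : Q -> sym C -> Q -> seq O -> dir -> Prop) (qf : Q).
Implicit Types (S V X Y : seq (sym C)) (tr : seq (Q * nat * seq O)).

(* [true] is the left side; the outcome [None] is acceptance inside the segment. *)
Definition entry V (b : bool) := if b then 1 else size V.

Definition outcome V (c : Q * nat) (r : option (bool * Q)) : Prop :=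
  match r with
  | Some (b, q) => c = (q, if b then 0 else (size V).+1)
  | None => c.1 = qf /\ 0 < c.2 <= size V
  end.

Definition behaves V (x : bool * Q) r (silent : bool) :=
  exists tr c, [/\ srun stp V (x.2, entry V x.1) tr c, outcome V c r
                 & silent = nilp (outs tr)].

(** The crossing relation of two-way automata, with one extra bit for the output. As a subset of a
    finite type it takes only finitely many values. *)
Definition behaviour V : {set (bool * Q) * option (bool * Q) * bool} :=
  [set x | `[< behaves V x.1.1 x.1.2 x.2 >]].

Lemma behaviourP V1 V2 x r s :
  behaviour V1 = behaviour V2 -> behaves V1 x r s -> behaves V2 x r s.
Proof.
move=> /setP /(_ (x, r, s)); rewrite !inE /= => E /asboolP H.
by apply/asboolP; rewrite -E.
Qed.

Lemma eq_behaviour V1 V2 :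
  (forall x r s, behaves V1 x r s -> behaves V2 x r s) ->
  (forall x r s, behaves V2 x r s -> behaves V1 x r s) ->
  behaviour V1 = behaviour V2.
Proof.
move=> H1 H2; apply/setP=> -[[x r] s]; rewrite !inE /=.
by apply/asboolP/asboolP; [exact: H1 | exact: H2].
Qed.

Definition inside a n (x : Q * nat * seq O) := a < x.1.2 <= a + n.
Definition outs_in a n tr := outs [seq x <- tr | inside a n x].
Definition outs_out a n tr := outs [seq x <- tr | ~~ inside a n x].

Lemma outs_in_cat a n tr1 tr2 :
  outs_in a n (tr1 ++ tr2) = outs_in a n tr1 ++ outs_in a n tr2.
Proof. by rewrite /outs_in filter_cat outs_cat. Qed.

Lemma outs_out_cat a n tr1 tr2 :
  outs_out a n (tr1 ++ tr2) = outs_out a n tr1 ++ outs_out a n tr2.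
Proof. by rewrite /outs_out filter_cat outs_cat. Qed.

Lemma size_outs_in_out a n tr :
  size (outs tr) = size (outs_in a n tr) + size (outs_out a n tr).
Proof.
elim: tr => // x tr IH; rewrite /outs_in /outs_out /=.
rewrite -/(outs_in a n tr) -/(outs_out a n tr) in IH *.
rewrite /outs /= size_cat -/(outs tr) IH.
by case: ifP => _; rewrite /= /outs /= size_cat -!/(outs _);
  rewrite -/(outs_in a n tr) -/(outs_out a n tr); lia.
Qed.

Lemma nil_outs_in_out a n tr :
  nilp (outs tr) = nilp (outs_in a n tr) && nilp (outs_out a n tr).
Proof. by rewrite /nilp (size_outs_in_out a n) addn_eq0. Qed.

Lemma outs_out_silent a n tr : outs_in a n tr = [::] -> outs_out a n tr = outs tr.
Proof.
elim: tr => // x tr IH; rewrite /outs_in /outs_out /=.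
case: ifP => _ /=; rewrite /outs /= -!/(outs _) -/(outs_out a n tr).
  by case: (x.2) => //= /IH ->.
by move=> /IH ->.
Qed.

Lemma srun_shift_in V a k tr c : srun stp V k tr c ->
  outs_in a (size V) (shift a tr) = outs tr /\ outs_out a (size V) (shift a tr) = [::].
Proof.
move=> r; have H x : List.In x (shift a tr) -> inside a (size V) x.
  case/List.in_map_iff => y [<- /(srun_pos r)]; rewrite /inside /=; lia.
rewrite /outs_in /outs_out -(outs_shift a tr).
elim: (shift a tr) H => // x t IH H /=.
have -> /= : inside a (size V) x by apply: H; left.
have [] := IH (fun y Hy => H y (or_intror Hy)).
by rewrite /outs /= => -> ->.
Qed.

Lemma srun_segment X V Y p k tr c r : k <= (size V).+1 ->
  srun stp (X ++ V ++ Y) (p, size X + k) tr c -> outcome (X ++ V ++ Y) c r ->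
  exists tr1 c1 r1 tr2, [/\ tr = shift (size X) tr1 ++ tr2,
    srun stp V (p, k) tr1 c1, outcome V c1 r1,
    srun stp (X ++ V ++ Y) (c1.1, size X + c1.2) tr2 c
    & r1 = None -> tr2 = [::] /\ r = None].
Proof.
elim: tr p k => [|x tr IH] p k kb run oc.
  inversion run; subst c; clear run.
  exists [::], (p, k).
  have [k0|k0] := posnP k.
    exists (Some (true, p)), [::]; split=> //; rewrite ?k0 //; exact: srun0.
  have [kV|kV] := leqP k (size V); last first.
    by exists (Some (false, p)), [::]; split=> //=; try exact: srun0; congr pair; lia.
  have rN : r = None.
    move: oc; case: r => // -[[] q] /= [_]; rewrite ?size_cat; lia.
  exists None, [::]; split=> //; try exact: srun0.
  by move: oc; rewrite rN /= => -[-> _]; split=> //; lia.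
have [k0|k0] := posnP k.
  exists [::], (p, k), (Some (true, p)), (x :: tr); split=> //=; last by rewrite k0.
  exact: srun0.
have [kV|kV] := leqP k (size V); last first.
  exists [::], (p, k), (Some (false, p)), (x :: tr); split=> //=; try exact: srun0.
  by congr pair; lia.
inversion run as [|p' i q o e tr' c' ib st rest]; subst.
have mE : mv e (size X + k) = size X + mv e k by case: (e) => /=; lia.
rewrite mE in rest.
have mb : mv e k <= (size V).+1 by case: (e) => /=; lia.
have [tr1 [c1 [r1 [tr2 [-> run1 oc1 run2 E]]]]] := IH _ _ mb rest oc.
exists ((p, k, o) :: tr1), c1, r1, tr2; split=> //.
apply: (srunS _ _ run1); first lia.
by move: st; rewrite cell_catr // cell_catl //; lia.
Qed.

(** * Replacing a segment by one of equal behaviour *)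

Section Replace.
Variables X V V' Y : seq (sym C).
Hypothesis eqV : behaviour V = behaviour V'.
Local Notation S := (X ++ V ++ Y).
Local Notation S' := (X ++ V' ++ Y).

(** Outside the replaced segment the output is kept literally; inside, only its being empty is kept,
    since a behaviour records no more. *)
Definition matched p i' tr r :=
  exists tr' c', [/\ srun stp S' (p, i') tr' c', outcome S' c' r,
    outs_out (size X) (size V) tr = outs_out (size X) (size V') tr' &
    nilp (outs_in (size X) (size V) tr) = nilp (outs_in (size X) (size V') tr')].

(** Corresponding positions outside [V] and [V'], including the two positions off the tape; those on
    the right are shifted by the difference of the lengths. *)
Definition outer i i' := (i <= size X /\ i' = i) \/
  exists2 k, i = (size X + size V + k).+1 & i' = (size X + size V' + k).+1.

Let Pouter n := forall p i i' tr c r, size tr <= n -> outer i i' ->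
  srun stp S (p, i) tr c -> outcome S c r -> matched p i' tr r.

Let Pinner n := forall p b tr c r, size tr <= n ->
  srun stp S (p, size X + entry V b) tr c -> outcome S c r ->
  matched p (size X + entry V' b) tr r.

(** The excursion into [V] is exchanged for one into [V'] with the same outcome. It takes no step if
    [V] is empty, so the remaining run must be handled with the same bound [n]. *)
Let inner_outer n : Pouter n -> Pinner n.
Proof.
move=> Hn p b tr c r sz run oc.
have eb : entry V b <= (size V).+1 by rewrite /entry; case: (b).
have [tr1 [c1 [r1 [tr2 [Etr run1 oc1 run2 EN]]]]] := srun_segment eb run oc.
have [tr1' [c1' [/= run1' oc1' Enil]]] :
    behaves V' (b, p) r1 (nilp (outs tr1)).
  by apply: (behaviourP eqV); exists tr1, c1.
have Erun := srun_embed X Y run1'.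
have [Ei Eo] := srun_shift_in (size X) run1.
have [Ei' Eo'] := srun_shift_in (size X) run1'.
case: r1 EN oc1 oc1' => [[b1 q1]|] EN oc1 oc1'; last first.
  have [E2 Er] := EN erefl; subst tr2 r.
  rewrite cats0 in Etr; exists (shift (size X) tr1'), (c1'.1, size X + c1'.2).
  split=> //; first by case: oc1' => -> ?; split=> //=; rewrite !size_cat; lia.
    by rewrite Etr Eo Eo'.
  by rewrite Etr Ei Ei'.
rewrite oc1 /= in run2; rewrite oc1' /= in Erun.
have ou : outer (size X + (if b1 then 0 else (size V).+1))
                (size X + (if b1 then 0 else (size V').+1)).
  by case: (b1); [left; rewrite addn0 | right; exists 0; lia].
have sz2 : size tr2 <= n by move: sz; rewrite Etr size_cat; lia.
have [tr2' [c' [run2' oc' Eo2 Ei2]]] := Hn _ _ _ _ _ _ sz2 ou run2 oc.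
exists (shift (size X) tr1' ++ tr2'), c'; split=> //; first exact: srun_cat run2'.
  by rewrite Etr !outs_out_cat Eo Eo' Eo2.
by rewrite Etr !outs_in_cat Ei Ei' /nilp !size_cat !addn_eq0 -!/(nilp _) Ei2 Enil.
Qed.

(** Strong induction on the length: a step made outside the segment is copied, after which the heads
    are again at corresponding outer positions or at the same entry of [V] and [V']. *)
Let outer_all n : Pouter n.
Proof.
elim/ltn_ind: n => n IH p i i' tr c r sz ou run oc.
case: tr sz run => [|x tr] sz run.
  inversion run; subst c; exists [::], (p, i'); split=> //; first exact: srun0.
  move: oc; case: r => [[[] q]|] /=.
  - by case=> -> Ei; case: ou => [[_ ->]|[k]]; rewrite Ei.
  - case=> -> Ei; congr pair; move: Ei; rewrite !size_cat.
    by case: ou => [[? ->]|[k -> ->]] //; lia.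
  - by case=> -> ib; split=> //; move: ib; rewrite !size_cat; case: ou => [[? ->]|[k -> ->]]; lia.
inversion run as [|p' i0 q o e tr' c' ib st rest]; subst.
have ib' : 0 < i' <= size S'.
  by move: ib; rewrite !size_cat; case: ou => [[? ->]|[k -> ->]]; lia.
have ce : cell S i = cell S' i'.
  case: ou => [[? ->]|[k -> ->]]; first by rewrite !cell_catl //; lia.
  by rewrite -!addnS -!addnA !cell_catr //; lia.
have nin : ~~ inside (size X) (size V) (p, i, o).
  by rewrite /inside /=; case: ou => [[? _]|[k -> _]]; lia.
have nin' : ~~ inside (size X) (size V') (p, i', o).
  by rewrite /inside /=; case: ou => [[? ->]|[k _ ->]]; lia.
suff [t' [c' [run' oc' Eo Ei]]] : matched q (mv e i') tr r.
  exists ((p, i', o) :: t'), c'; split=> //.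
  - by apply: srunS run' => //; rewrite -ce.
  - by rewrite /outs_out /= nin nin' /outs /=; congr cat.
  - by rewrite /outs_in /= (negbTE nin) (negbTE nin').
have szt : size tr < n by [].
have [|nou] := pselect (outer (mv e i) (mv e i')).
  by move=> ou'; apply: (IH _ szt) ou' rest oc.
have Hin := inner_outer (IH _ szt).
(* The positions stop corresponding only when a border of the segment is crossed, either from
   [size X] to the right or from the first cell of [Y] to the left. *)
have [b -> Ei] : exists2 b, mv e i' = size X + entry V' b & mv e i = size X + entry V b.
  case: ou => [[iX E]|[k E E']].
    have Ei : i = size X.
      apply/eqP/negPn/negP => Ei; apply: nou; left; case: (e); rewrite /=; lia.
    case: (e) nou => /= nou; try by case: nou; left; lia.
    by exists true; rewrite /entry; lia.
  have k0 : k = 0.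
    apply/eqP/negPn/negP => k0; apply: nou; right.
    by case: (e) => /=; [exists k.-1 | exists k | exists k.+1]; lia.
  case: (e) nou => /= nou; first by exists false; rewrite /entry; lia.
    by case: nou; right; exists 0; lia.
  by case: nou; right; exists 1; lia.
by apply: (Hin _ _ _ c) => //; rewrite -Ei.
Qed.

Lemma replace_run p b tr c r : srun stp S (p, entry S b) tr c -> outcome S c r ->
  matched p (entry S' b) tr r.
Proof.
move=> run oc.
have HO := @outer_all (size tr).
have [ou|nou] := pselect (outer (entry S b) (entry S' b)); first exact: HO ou run oc.
have [E E'] : entry S' b = size X + entry V' b /\ entry S b = size X + entry V b.
  move: nou; rewrite /entry; case: (b) => nou.
    by case: (posnP (size X)) => [->//|?]; case: nou; left.
  move: nou; rewrite !size_cat; case: (posnP (size Y)) => ? nou; first by lia.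
  by case: nou; right; exists (size Y).-1; lia.
by rewrite E; apply: (inner_outer HO) oc => //; rewrite -E'.
Qed.

Lemma behaves_replace x r s : behaves S x r s -> behaves S' x r s.
Proof.
case: x => b p [tr [c [/= run oc ->]]].
have [tr' [c' [run' oc' Eo Ei]]] := replace_run run oc.
exists tr', c'; split=> //.
by rewrite (nil_outs_in_out (size X) (size V)) (nil_outs_in_out (size X) (size V') tr') Eo Ei.
Qed.

Lemma replace_accepts q0 tr : accepts stp q0 qf S tr ->
  exists tr', [/\ accepts stp q0 qf S' tr',
    outs_out (size X) (size V) tr = outs_out (size X) (size V') tr' &
    nilp (outs_in (size X) (size V) tr) = nilp (outs_in (size X) (size V') tr')].
Proof.
case=> i ib run.
have [tr' [c' [run' [oc1 oc2] Eo Ei]]] := @replace_run q0 true tr (qf, i) None run (conj erefl ib).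
exists tr'; split=> //; exists c'.2 => //.
by rewrite (surjective_pairing c') oc1 in run'.
Qed.

End Replace.

Lemma behaviour_cat X V V' Y : behaviour V = behaviour V' ->
  behaviour (X ++ V ++ Y) = behaviour (X ++ V' ++ Y).
Proof. by move=> E; apply: eq_behaviour => x r s; apply: behaves_replace. Qed.

End Behaviour.

(** * Silent loops of the intermediate word *)

Section Loops.
Variables (Q : finType) (C O : Type).
Variables (stp : Q -> sym C -> Q -> seq O -> dir -> Prop) (q0 qf : Q).
Hypothesis stp_final : forall s q o e, ~ stp qf s q o e.
Hypothesis stp_det : forall p s q o e q' o' e',
  stp p s q o e -> stp p s q' o' e' -> [/\ q = q', o = o' & e = e'].
Implicit Types (S V X Y : seq (sym C)) (tr : seq (Q * nat * seq O)).
Local Notation acc := (accepts stp q0 qf).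
Local Notation beh := (behaviour stp qf).

Lemma accepts_uniq S tr1 tr2 : acc S tr1 -> acc S tr2 -> tr1 = tr2.
Proof.
case=> i1 _ r1 [i2 _ r2].
have [c1 Ec1] : exists c1, c1 = (qf, i1) by exists (qf, i1).
rewrite -Ec1 in r1; move: r2 Ec1.
elim: r1 tr2 => {tr1 c1} [c|p i q o e tr c ib st _ IH] tr2 r2 E.
  by rewrite {}E in r2; inversion r2 as [|? ? ? ? ? ? ? ? st]; subst => //; case: (stp_final st).
inversion r2 as [|p' i' q' o' e' tr' c' ib' st' r']; subst; first by case: (stp_final st).
have [? ? ?] := stp_det st st'; subst.
by rewrite (IH _ r').
Qed.

Lemma eq_filter_In (T : Type) (a1 a2 : pred T) (s : seq T) :
  (forall x, List.In x s -> a1 x = a2 x) -> filter a1 s = filter a2 s.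
Proof.
elim: s => //= x s IH H; rewrite H; last by left.
by rewrite IH // => y Hy; apply: H; right.
Qed.

(** What lies outside the exchanged suffix is exactly the prefix, because the run stays on the tape;
    so the output written there survives the exchange. *)
Lemma accepts_suffix X Y Y' tr : beh Y = beh Y' -> acc (X ++ Y) tr ->
  exists2 tr', acc (X ++ Y') tr' & outs_in 0 (size X) tr = outs_in 0 (size X) tr'.
Proof.
move=> E a.
have H Z t : acc (X ++ Z) t -> outs_out (size X) (size Z) t = outs_in 0 (size X) t.
  case=> i _ r; rewrite /outs_out /outs_in; congr outs.
  by apply: eq_filter_In => x /(srun_pos r); rewrite size_cat /inside; lia.
have := @replace_accepts _ _ _ _ _ X _ _ [::] E q0 tr.
rewrite !cats0 => /(_ a) [tr' [a' Eo _]].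
by exists tr' => //; rewrite -!(H _ _ a) Eo (H _ _ a').
Qed.

Lemma accepts_prefix X X' Y tr : beh X = beh X' -> acc (X ++ Y) tr ->
  exists2 tr', acc (X' ++ Y) tr' & outs_out 0 (size X) tr = outs_out 0 (size X') tr'.
Proof.
move=> E a.
have [tr' [a' Eo _]] := @replace_accepts _ _ _ _ _ [::] _ _ Y E q0 tr a.
by exists tr'.
Qed.

Lemma size_outs_in_add m n tr :
  size (outs_in 0 (m + n) tr) = size (outs_in 0 m tr) + size (outs_in m n tr).
Proof.
elim: tr => // x tr; rewrite /outs_in /= => IH.
have [] : [\/ [/\ inside 0 (m + n) x, inside 0 m x & ~~ inside m n x],
    [/\ inside 0 (m + n) x, ~~ inside 0 m x & inside m n x] |
    [/\ ~~ inside 0 (m + n) x, ~~ inside 0 m x & ~~ inside m n x]].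
  rewrite /inside; case E1: (0 < x.1.2 <= 0 + m).
    by apply: Or31; split; lia.
  case E2: (m < x.1.2 <= m + n); first by apply: Or32; split; lia.
  by apply: Or33; split; lia.
- by case=> -> -> /negbTE->; rewrite /outs /= !size_cat -!/(outs _) IH; lia.
- by case=> -> /negbTE-> ->; rewrite /outs /= !size_cat -!/(outs _) IH; lia.
- by case=> /negbTE-> /negbTE-> /negbTE->.
Qed.

(* Let A_i be the output size of the accepting run in the prefix [X V^i], and B_j
   the one in the suffix [V^j Y]. These do not depend on what is on the other
   side, so A_i + B_j only depends on i + j; if A_1 > A_0 then B_j grows with j. *)
Lemma loop_silent X V Y tr K :
  beh (X ++ V) = beh X -> beh (V ++ Y) = beh Y ->
  (forall n tr', acc (X ++ iter n (cat V) Y) tr' -> size (outs tr') <= K) ->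
  acc (X ++ V ++ Y) tr -> outs_in (size X) (size V) tr = [::].
Proof.
move=> bX bY bnd a; apply/nilP; apply/negPn/negP => nnil.
pose Z n := iter n (cat V) Y.
have bZ n : beh (Z n) = beh Y.
  elim: n => // n IH; rewrite /Z /= -bY.
  by have := behaviour_cat V [::] IH; rewrite !cats0.
suff [n [tr' a' le]] : exists n, exists2 tr', acc (X ++ Z n) tr' &
    K < size (outs_out 0 (size X) tr').
  by have := bnd n tr' a'; rewrite (size_outs_in_out 0 (size X)); lia.
exists K.+1; elim: K.+1 => [|n [t0 a0 le0]].
  have [tr' a' _] := accepts_suffix bY a.
  by exists tr'.
have bVZ : beh (V ++ Y) = beh (V ++ Z n).
  by have := behaviour_cat V [::] (esym (bZ n)); rewrite !cats0.
have [t1 a1 E1] := accepts_suffix (X := X) bVZ a.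
exists t1 => //.
have a1' : acc ((X ++ V) ++ Z n) t1 by rewrite -catA.
have [t2 a2 E2] := accepts_prefix (esym bX) a0.
have ? := accepts_uniq a2 a1'; subst t2.
have bYZ : beh (V ++ Y) = beh (Z n) by rewrite bZ.
have [t3 a3 E3] := accepts_suffix (X := X) bYZ a.
have ? := accepts_uniq a3 a0; subst t3.
have a' : acc ((X ++ V) ++ Y) tr by rewrite -catA.
have [t4 a4 E4] := accepts_suffix (esym (bZ n)) a'.
have ? := accepts_uniq a4 a1'; subst t4.
(* The output of [t1] is measured twice: as A_0 + B_(n+1), cutting after [X], and as A_1 + B_n,
   cutting after [X ++ V]. *)
have := size_outs_in_out 0 (size X) t1.
rewrite (size_outs_in_out 0 (size (X ++ V)) t1) -E2 -E4 -E1.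
rewrite size_cat size_outs_in_add; move: nnil; rewrite /nilp; lia.
Qed.

End Loops.

(** * Bounding the number of visits *)

Lemma pigeonhole (I : eqType) (K : finType) (f : I -> K) (s : seq I) :
  uniq s -> #|K| < size s -> exists x y, [/\ x \in s, y \in s, x != y & f x = f y].
Proof.
move=> us lt; have [inj|ninj] := boolP (uniq (map f s)).
  by have := max_card (mem (map f s)); rewrite (card_uniqP inj) size_map; lia.
elim: s us ninj {lt} => //= x s IH /andP[xs us].
case: (boolP (f x \in map f s)) => [/mapP[y ys E] _|_ /= /(IH us)].
  exists x, y; rewrite !inE ys eqxx orbT; split=> //.
  by apply: contraNneq xs => ->.
by case=> y [z [ys zs yz E]]; exists y, z; rewrite !inE ys zs !orbT.
Qed.

Section Bounded.
Variables (A C B : Type) (Qn Qd : finType).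
Variables (nstp : Qn -> sym A -> Qn -> seq C -> dir -> Prop) (n0 nf : Qn).
Variables (dstp : Qd -> sym C -> Qd -> seq B -> dir -> Prop) (d0 df : Qd).
Hypothesis dstp_final : forall s q o e, ~ dstp df s q o e.
Hypothesis dstp_det : forall p s q o e q' o' e',
  dstp p s q o e -> dstp p s q' o' e' -> [/\ q = q', o = o' & e = e'].
Implicit Types (tr : seq (Qn * nat * seq C)).
Local Notation nacc w := (accepts nstp n0 nf (marked w)).
Local Notation dacc u := (accepts dstp d0 df (marked u)).
Local Notation beh := (behaviour dstp df).

Definition composed w z :=
  exists tr trd, [/\ nacc w tr, dacc (outs tr) trd & outs trd = z].

Definition class := {set (bool * Qd) * option (bool * Qd) * bool}.
(* Locked, as [done] would otherwise try to evaluate this cardinal. *)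
Definition max_visits := locked #|{: class * class * class}|.

Definition visits tr c := count (fun x => x.1 == c) tr.

Lemma marked_cat (D : Type) (u1 v u2 : seq D) :
  marked (u1 ++ v ++ u2) = (LM :: map (@Sy D) u1) ++ map (@Sy D) v ++ (map (@Sy D) u2 ++ [:: RM]).
Proof. by rewrite /marked !map_cat -!catA. Qed.

Lemma srun_iter S c tr n : srun nstp S c tr c -> srun nstp S c (iter n (cat tr) [::]) c.
Proof. by move=> r; elim: n => [|n IH]; [exact: srun0 | exact: srun_cat r IH]. Qed.

Lemma outs_iter n tr : outs (iter n (cat tr) [::]) = iter n (cat (outs tr)) [::].
Proof. by elim: n => //= n IH; rewrite outs_cat IH. Qed.

Lemma iter_cat (T : Type) (s t : seq T) n : iter n (cat s) t = iter n (cat s) [::] ++ t.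
Proof. by elim: n => //= n ->; rewrite catA. Qed.

Lemma map_iter_cat (T1 T2 : Type) (f : T1 -> T2) s n :
  map f (iter n (cat s) [::]) = iter n (cat (map f s)) [::].
Proof. by elim: n => //= n IH; rewrite map_cat IH. Qed.

Lemma take_segment (T : Type) (s : seq T) j k : j <= k ->
  take k s = take j s ++ drop j (take k s).
Proof. by move=> jk; rewrite -{1}(cat_take_drop j (take k s)) take_takel. Qed.

Lemma drop_segment (T : Type) (s : seq T) j k : j <= k -> k < size s ->
  drop j s = drop j (take k s) ++ drop k s.
Proof.
move=> jk lt; rewrite -{1}(cat_take_drop k s) drop_cat size_take lt.
case: ltnP => // kj; have -> : j = k by apply/eqP; rewrite eqn_leq jk.
by rewrite subnn drop0 (@drop_oversize _ _ (take k s)) ?size_take ?lt.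
Qed.

Section Visits.
Variables (S : seq (sym A)) (c c1 c2 : Qn * nat) (x : Qn * nat * seq C) (tr : seq (Qn * nat * seq C)).
Hypothesis run : srun nstp S c1 tr c2.

Lemma srun_visit k : k < size tr -> (nth x tr k).1 == c ->
  srun nstp S c1 (take k tr) c /\ srun nstp S c (drop k tr) c2.
Proof.
move=> lt /eqP h; move: run; rewrite -{1}(cat_take_drop k tr) => /srun_split[c' ra rb].
suff <- : c' = c by [].
by move: rb; rewrite (drop_nth x lt) (surjective_pairing (nth _ _ _)) => /srun_head ->.
Qed.

Lemma srun_loop j k : j <= k -> k < size tr ->
  (nth x tr j).1 == c -> (nth x tr k).1 == c -> srun nstp S c (drop j (take k tr)) c.
Proof.
move=> jk lt hj /eqP hk; have [_] := srun_visit (leq_ltn_trans jk lt) hj.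
rewrite (drop_segment jk lt) => /srun_split[c' ra rb].
suff E : c' = c by move: ra; rewrite E.
by move: rb; rewrite (drop_nth x lt) (surjective_pairing (nth _ _ _)) => /srun_head ->.
Qed.

End Visits.

Section Shorten.
Variables (w : seq A) (K : nat).
Hypothesis bnd : forall z, composed w z -> size z <= K.

(** Repeating [tr2] any number of times gives again a run of the nondeterministic machine, so [bnd]
    bounds the output on all pumped words, as [loop_silent] demands. *)
Lemma composed_loop_silent i c tr1 tr2 tr3 trd :
  0 < i <= size (marked w) ->
  srun nstp (marked w) (n0, 1) tr1 c -> srun nstp (marked w) c tr2 c ->
  srun nstp (marked w) c tr3 (nf, i) ->
  let X := LM :: map (@Sy C) (outs tr1) in let V := map (@Sy C) (outs tr2) in
  let Y := map (@Sy C) (outs tr3) ++ [:: RM] in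
  beh (X ++ V) = beh X -> beh (V ++ Y) = beh Y ->
  accepts dstp d0 df (X ++ V ++ Y) trd -> outs_in (size X) (size V) trd = [::].
Proof.
move=> ib r1 r2 r3 X V Y bX bY acc.
apply: (loop_silent dstp_final dstp_det (K := K) bX bY _ acc) => n trd' acc'.
apply: bnd; exists (tr1 ++ iter n (cat tr2) [::] ++ tr3), trd'; split=> //.
  exists i => //; apply: srun_cat r1 _; apply: srun_cat r3; exact: srun_iter.
rewrite !outs_cat outs_iter marked_cat.
by move: acc'; rewrite iter_cat map_iter_cat.
Qed.

(** Each visit of [c] is coloured by the behaviours of the prefix before it, of the suffix after it,
    and of the segment leading to it from its anchor [base]. Two visits [k1 < k2] of the same colour
    have the same anchor [b]. The segment from [b] to [k2] is a silent loop, and the shorter one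
    from [b] to [k1] can take its place, which drops the part of the run between [k1] and [k2]. *)
Lemma shorten tr trd c : nacc w tr -> dacc (outs tr) trd -> max_visits < visits tr c ->
  exists tr' trd', [/\ nacc w tr', dacc (outs tr') trd', outs trd' = outs trd &
    size tr' < size tr].
Proof.
case=> i ib run acc many.
pose pre k := LM :: map (@Sy C) (outs (take k tr)).
pose suf k := map (@Sy C) (outs (drop k tr)) ++ [:: RM].
pose seg j k := map (@Sy C) (outs (drop j (take k tr))).
pose hit k := (nth (c.1, c.2.+1, [::]) tr k).1 == c.
pose P k j := hit j && ((beh (pre j), beh (suf j)) == (beh (pre k), beh (suf k))).
(* The anchor is the first visit with the same classes of prefix and suffix, so that it depends on
   these classes only. *)
pose base k := find (P k) (iota 0 (size tr)).
pose ks := [seq k <- iota 0 (size tr) | hit k].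
pose same j k := [/\ beh (pre j) = beh (pre k), beh (suf j) = beh (suf k) &
  beh (seg (base j) j) = beh (seg (base k) k)].
have [k1 [k2 [k1s k2s lt12 E]]] : exists k1 k2, [/\ k1 \in ks, k2 \in ks, k1 < k2 & same k1 k2].
  pose col k := ((beh (pre k), beh (suf k)), beh (seg (base k) k)) : class * class * class.
  have sameP j k : col j = col k -> same j k.
    move=> E; apply: And3; first exact: (congr1 (fun x => x.1.1) E).
      exact: (congr1 (fun x => x.1.2) E).
    exact: (congr1 snd E).
  have szks : size ks = visits tr c.
    rewrite size_filter /visits -[tr in RHS](mkseq_nth (c.1, c.2.+1, [::])).
    by rewrite count_map; apply: eq_count.
  have uks : uniq ks by rewrite filter_uniq // iota_uniq.
  rewrite /max_visits -lock -szks in many.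
  have [k1 [k2 [k1s k2s ne E]]] := pigeonhole col uks many.
  move: ne; rewrite neq_ltn => /orP[lt|lt].
    by exists k1, k2; exact: And4 k1s k2s lt (sameP _ _ E).
  by exists k2, k1; exact: And4 k2s k1s lt (sameP _ _ (esym E)).
have hitP k : k \in ks -> k < size tr /\ hit k.
  by rewrite mem_filter mem_iota => /andP[-> /andP[_ ->]].
have [[lt1 h1] [lt2 h2]] := (hitP _ k1s, hitP _ k2s).
have Eb : base k2 = base k1 by case: E => E1 E2 _; rewrite /base /P E1 E2.
have [b Db] : exists b, base k1 = b by exists (base k1).
rewrite /same Eb Db in E.
have hasP : has (P k1) (iota 0 (size tr)).
  by apply/hasP; exists k1; [rewrite mem_iota | rewrite /P h1 eqxx].
have ltb : b < size tr by move: hasP; rewrite has_find size_iota -/(base k1) Db.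
have /andP[hb Eps] : P k1 b.
  by have := nth_find 0 hasP; rewrite -/(base k1) Db nth_iota.
have b1 : b <= k1.
  rewrite leqNgt; apply/negP => lt.
  have := @before_find _ 0 (P k1) (iota 0 (size tr)) k1.
  by rewrite -/(base k1) Db nth_iota // /P h1 eqxx => /(_ lt).
have b2 : b <= k2 := leq_trans b1 (ltnW lt12).
have preE k : b <= k -> pre k = pre b ++ seg b k.
  by move=> bk; rewrite /pre (take_segment _ bk) outs_cat map_cat.
have sufE : suf b = seg b k2 ++ suf k2.
  by rewrite /suf (drop_segment b2 lt2) outs_cat map_cat -catA.
have splitE k : b <= k ->
    marked (outs (take k tr ++ drop k2 tr)) = pre b ++ seg b k ++ suf k2.
  by move=> bk; rewrite (take_segment _ bk) -catA !outs_cat marked_cat.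
have acc' : accepts dstp d0 df (pre b ++ seg b k2 ++ suf k2) trd.
  by rewrite -splitE // cat_take_drop.
(* Visits [b] and [k2] agree in the classes of prefix and suffix, so the part between them satisfies
   the two absorption equations of a loop. *)
have silent : outs_in (size (pre b)) (size (seg b k2)) trd = [::].
  apply: (composed_loop_silent ib _ (srun_loop run b2 lt2 hb h2) _ _ _ acc').
  - exact: (srun_visit run ltb hb).1.
  - exact: (srun_visit run lt2 h2).2.
  - by rewrite -(preE k2) //; case: E => <- _ _; case/eqP: Eps => ->.
  - by rewrite -/(suf k2) -/(seg b k2) -sufE; case: E => _ <- _; case/eqP: Eps => _ ->.
have [trd' [acc2 Eo Ei]] : exists trd', [/\ accepts dstp d0 df (pre b ++ seg b k1 ++ suf k2) trd',
    outs_out (size (pre b)) (size (seg b k2)) trd = outs_out (size (pre b)) (size (seg b k1)) trd' &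
    nilp (outs_in (size (pre b)) (size (seg b k2)) trd) =
    nilp (outs_in (size (pre b)) (size (seg b k1)) trd')].
  by case: E => _ _ /esym E; exact: replace_accepts E _ _ acc'.
exists (take k1 tr ++ drop k2 tr), trd'; split.
- by exists i => //; apply: srun_cat (srun_visit run lt1 h1).1 (srun_visit run lt2 h2).2.
- by rewrite splitE.
(* Both [seg b k2] and its substitute [seg b k1] are silent, so the whole output is written outside
   them, where it is unchanged. *)
- rewrite -(outs_out_silent silent) Eo outs_out_silent //.
  by apply/nilP; rewrite -Ei silent.
- by rewrite size_cat size_take lt1 size_drop; clear -lt12 lt2; lia.
Qed.

Lemma bounded_visits tr trd : nacc w tr -> dacc (outs tr) trd ->
  exists tr' trd', [/\ nacc w tr', dacc (outs tr') trd', outs trd' = outs trd &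
    forall c, visits tr' c <= max_visits].
Proof.
elim/ltn_ind: {tr}(size tr) {-2}tr (leqnn (size tr)) trd => n IH tr sz trd a1 a2.
have [H|H] := pselect (forall c, visits tr c <= max_visits); first by exists tr, trd.
have [c /negP] : exists c, ~ visits tr c <= max_visits by apply/existsNP.
rewrite -ltnNge => many.
have [tr1 [trd1 [b1 b2 E lt]]] := shorten a1 a2 many.
have lt' : size tr1 < n by lia.
have [tr2 [trd2 [? ? E2 ?]]] := IH _ lt' tr1 (leqnn _) trd1 b1 b2.
by exists tr2, trd2; split=> //; rewrite E2.
Qed.

End Shorten.
End Bounded.

(** * Machines given by transition tables *)

Section GsmRuns.
Variables (A B : finType) (M : gsm A B).

Definition gsm_step p s q o e := exists t : instr (gQ M) A B,
  [/\ List.In t (gdelta M), ip t = p &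
    if s == isig t then [/\ q = iq1 t, o = ia1 t & e = ie1 t]
    else [/\ q = iq0 t, o = ia0 t & e = ie0 t]].

(** Positions counted from 0 become positions counted from 1; a failing [move] corresponds to
    reaching 0. *)
Lemma move_mv e i j : move e i = Some j <-> mv e i.+1 = j.+1.
Proof. by case: e => /=; [case: i => [|i] | |]; split=> //; case=> ->. Qed.

Lemma step_gsm_step w p i z q j z' : step (M := M) w (p, i, z) (q, j, z') <->
  j < size (marked w) /\
  exists o e, [/\ gsm_step p (nth LM (marked w) i) q o e, mv e i.+1 = j.+1 & z' = z ++ o].
Proof.
split=> [[t [It [Ep [jb H]]]]|[jb [o [e [[t [It Ep H]] Em Ez]]]]].
  split=> //; case: H => [[s_t [-> [-> /move_mv Em]]]|[s_t [-> [-> /move_mv Em]]]].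
    by exists (ia1 t), (ie1 t); split=> //; exists t; split=> //; rewrite s_t eqxx.
  by exists (ia0 t), (ie0 t); split=> //; exists t; split=> //; case: eqP.
exists t; split=> //; split=> //; split=> //=; move: H; case: eqP => s_t [-> Eo Ee].
  by left; rewrite -Eo -Ee; split=> //; split=> //; split=> //; apply/move_mv.
by right; rewrite -Eo -Ee; split=> //; split=> //; split=> //; apply/move_mv.
Qed.

Lemma reach_srun w c1 c2 : reach (M := M) w c1 c2 ->
  c1.1.2 < size (marked w) ->
  c2.1.2 < size (marked w) /\ exists2 tr,
    srun gsm_step (marked w) (c1.1.1, c1.1.2.+1) tr (c2.1.1, c2.1.2.+1)
    & c2.2 = c1.2 ++ outs tr.
Proof.
elim=> {c1 c2} [c cb|c1 c2 c3]; first by split=> //; exists [::]; rewrite ?cats0 //; exact: srun0.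
case: c1 c2 => [[p i] z] [[q j] z'] /step_gsm_step[jb [o [e [st Em Ez]]]] _ IH /= ib.
have [cb [tr r E]] := IH jb; split=> //.
exists ((p, i.+1, o) :: tr); last by rewrite E /= Ez -catA.
by rewrite /= -Em in r; apply: srunS r; [exact: ib | exact: st].
Qed.

Lemma srun_reach w c1 tr c2 : srun gsm_step (marked w) c1 tr c2 ->
  0 < c1.2 <= size (marked w) -> 0 < c2.2 <= size (marked w) -> forall z,
  reach (M := M) w (c1.1, c1.2.-1, z) (c2.1, c2.2.-1, z ++ outs tr).
Proof.
elim=> {c1 tr c2} [c _ _ z|p i q o e tr c ib st r IH _ cb z]; first by rewrite cats0; exact: reach_refl.
have mb : 0 < mv e i <= size (marked w) by inversion r; subst.
rewrite /= in IH *; apply: (reach_step (c2 := (q, (mv e i).-1, z ++ o))).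
  apply/step_gsm_step; split; first lia.
  by exists o, e; split=> //; rewrite !prednK //; lia.
by rewrite /outs /= catA; exact: IH.
Qed.

Lemma realizedE w z : realized M w z <->
  exists2 tr, accepts gsm_step (gqin M) (gqf M) (marked w) tr & outs tr = z.
Proof.
split=> [[i H]|[tr [i ib r] <-]]; last by exists i.-1; apply: (srun_reach r).
have [ib [tr r E]] := reach_srun H (ltn0Sn _).
by exists tr => //; exists i.+1.
Qed.

End GsmRuns.

Definition table_step (Q A B : Type) (delta : Q -> sym A -> option (Q * seq B * dir))
  p s q o e := delta p s = Some (q, o, e).

Lemma In_mem (T : eqType) (x : T) s : List.In x s <-> x \in s.
Proof.
elim: s => //= y s IH; rewrite inE; split=> [[->|/IH ->]|/orP[/eqP->|/IH]]; rewrite ?eqxx ?orbT //; by [left|right].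
Qed.

(* In the state [Some (q, k)] the machine tests whether the scanned symbol is the
   [k]-th letter; [None] is a dead state. *)
Section Compile.
Variables (A B Q : finType) (delta : Q -> sym A -> option (Q * seq B * dir)) (q0 qf : Q).
Hypothesis delta_final : forall s, delta qf s = None.

Local Notation St := (option (Q * 'I_(#|{: sym A}|.+1))).

(** An instruction tests one symbol only, so the table row of [q] becomes a chain of tests in the
    order of [enum_val]. A failed test changes neither head nor output; a successful one without a
    table entry leads to the dead state. *)
Definition table_instr (x : Q * 'I_#|{: sym A}|) : instr St A B :=
  let: (q, k) := x in
  let: (q1, o1, e1) := if delta q (enum_val k) is Some (q', o, e)
    then (Some (q', ord0), o, e) else (None, [::], Stay) in
  Instr (Some (q, inord k)) (enum_val k) q1 o1 e1 (Some (q, inord k.+1)) [::] Stay.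

Definition table_instrs :=
  map table_instr [seq x <- enum {: Q * 'I_#|{: sym A}|} | x.1 != qf].

Lemma ip_table_instr x : ip (table_instr x) = Some (x.1, inord x.2).
Proof. by case: x => q k /=; case: delta => [[[]]|]. Qed.

Lemma isig_table_instr x : isig (table_instr x) = enum_val x.2.
Proof. by case: x => q k /=; case: delta => [[[]]|]. Qed.

Lemma table_instrsP t : List.In t table_instrs <-> exists2 x, x.1 != qf & t = table_instr x.
Proof.
rewrite /table_instrs List.in_map_iff; split=> [[x [<- /In_mem]]|[x xf ->]].
  by rewrite mem_filter => /andP[xf _]; exists x.
by exists x; split=> //; apply/In_mem; rewrite mem_filter xf mem_enum.
Qed.

Lemma table_gsm_wf t : List.In t table_instrs -> ip t <> Some (qf, ord0).
Proof.
by case/table_instrsP => x xf ->; rewrite ip_table_instr => -[E _]; rewrite E eqxx in xf.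
Qed.

Definition table_gsm : gsm A B := @Gsm A B St table_instrs (Some (q0, ord0)) (Some (qf, ord0)) table_gsm_wf.

Lemma table_gsm_deterministic : deterministic table_gsm.
Proof.
move=> t1 t2 /table_instrsP[[p j] _ ->] /table_instrsP[[q k] _ ->].
rewrite !ip_table_instr /= => -[-> /(congr1 val)]; rewrite /= !inordK; try by apply: ltnW; rewrite ltnS ltn_ord.
by move/val_inj ->.
Qed.

Lemma gsm_step_tableP p s q o e : gsm_step (M := table_gsm) p s q o e ->
  exists p' k, p = Some (p', k) /\
   (q = None \/ (exists2 k', q = Some (p', k') & o = [::] /\ e = Stay) \/
    exists2 q', q = Some (q', ord0) & delta p' s = Some (q', o, e)).
Proof.
case=> t [/table_instrsP[[p' k] pf ->] <-]; rewrite ip_table_instr isig_table_instr /=.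
case: eqP => [->|_].
  case D: delta => [[[q' o'] e']|] /= [-> -> ->]; exists p', (inord k); split=> //; last by left.
  by right; right; exists q'.
case: delta => [[[q' o'] e']|] /= [-> -> ->]; exists p', (inord k); split=> //; right; left; by exists (inord k.+1).
Qed.

Lemma table_gsm_sound S c1 tr c2 : srun (gsm_step (M := table_gsm)) S c1 tr c2 ->
  forall p k q l, c1.1 = Some (p, k) -> c2.1 = Some (q, l) ->
  exists2 tr', srun (table_step delta) S (p, c1.2) tr' (q, c2.2) & outs tr = outs tr'.
Proof.
elim=> {c1 tr c2} [c p k q l -> [-> _]|p i q o e tr c ib st r IH p1 k1 q1 l /= Ep Eq].
  by exists [::] => //; exact: srun0.
have [p' [k [Ep' H]]] := gsm_step_tableP st.
have ? : p' = p1 by move: Ep'; rewrite Ep => -[].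
subst p'; case: H => [Eq0|[[k' Eq0 [Eo Ee]]|[q' Eq0 D]]].
- move: Eq; rewrite {}Eq0 in r; inversion r as [|? ? ? ? ? ? ? ? st']; subst => //.
  by have [? [? []]] := gsm_step_tableP st'.
- by have [tr' r' E] := IH _ _ _ _ Eq0 Eq; exists tr' => //; [rewrite Ee in r' | rewrite Eo].
- have [tr' r' E] := IH _ _ _ _ Eq0 Eq.
  exists ((p1, i, o) :: tr'); last by rewrite /outs /=; congr cat.
  exact: srunS D r'.
Qed.

(** Induction on the number of failing tests that precede the test of the scanned letter. *)
Lemma table_gsm_tests S p i q o e k : 0 < i <= size S -> p != qf ->
  delta p (cell S i) = Some (q, o, e) -> k <= enum_rank (cell S i) ->
  exists2 tr, srun (gsm_step (M := table_gsm)) S (Some (p, inord k), i) tr (Some (q, ord0), mv e i)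
    & outs tr = o.
Proof.
move=> ib pf D; move En : (enum_rank (cell S i) - k) => n kr.
elim: n k En kr => [|n IH] k En kr.
  have Ek : k = enum_rank (cell S i) by lia.
  exists [:: (Some (p, inord k), i, o)]; last by rewrite /outs /= cats0.
  apply: (srunS ib _ (srun0 )).
  exists (table_instr (p, enum_rank (cell S i))); split.
  - by apply/table_instrsP; exists (p, enum_rank (cell S i)).
  - by rewrite ip_table_instr Ek.
  - by rewrite isig_table_instr /= enum_rankK eqxx D.
have kb : k < #|{: sym A}| by apply: leq_ltn_trans kr (ltn_ord _).
have [||tr r E] := IH k.+1; try lia.
exists ((Some (p, inord k), i, [::]) :: tr) => //.
apply: (@srunS _ _ _ _ _ _ _ (Some (p, inord k.+1)) _ Stay) => //.
exists (table_instr (p, Ordinal kb)); split.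
- by apply/table_instrsP; exists (p, Ordinal kb).
- by rewrite ip_table_instr.
- rewrite isig_table_instr /=.
  case: eqP => [Ec|_]; last by case: delta => [[[]]|].
  by move: En; rewrite Ec enum_valK /=; lia.
Qed.

Lemma table_gsm_complete S c1 tr c2 : srun (table_step delta) S c1 tr c2 ->
  exists2 tr', srun (gsm_step (M := table_gsm)) S (Some (c1.1, ord0), c1.2) tr' (Some (c2.1, ord0), c2.2)
    & outs tr' = outs tr.
Proof.
elim=> {c1 tr c2} [c|p i q o e tr c ib st r [tr2 r2 E2]]; first by exists [::] => //; exact: srun0.
have pf : p != qf by apply/eqP => E; move: st; rewrite /table_step E delta_final.
have [tr1 r1 E1] := table_gsm_tests ib pf st (leq0n _).
exists (tr1 ++ tr2); last by rewrite outs_cat E1 E2.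
apply: srun_cat r2; suff E0 : @ord0 #|{: sym A}| = inord 0 by rewrite E0 in r1 *.
by apply: val_inj; rewrite /= inordK.
Qed.

Lemma table_gsm_realized w z : realized table_gsm w z <->
  exists2 tr, accepts (table_step delta) q0 qf (marked w) tr & outs tr = z.
Proof.
rewrite realizedE; split=> [[tr [i ib r] <-]|[tr [i ib r] <-]].
  have [tr' r' E] := table_gsm_sound r erefl erefl.
  by exists tr' => //; exists i.
have [tr' r' E] := table_gsm_complete r.
by exists tr' => //; exists i.
Qed.

End Compile.

Lemma DGSM_table (A B Q : finType) (delta : Q -> sym A -> option (Q * seq B * dir)) (q0 qf : Q) :
  (forall s, delta qf s = None) ->
  in_DGSM (fun w z => exists2 tr, accepts (table_step delta) q0 qf (marked w) tr & outs tr = z).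
Proof.
move=> df; exists (table_gsm delta q0 qf); split; first exact: table_gsm_deterministic.
by move=> w z; rewrite table_gsm_realized.
Qed.

(** * Simulating a composition along a labelled run *)

Definition opposite e := match e with Lft => Rgt | Stay => Stay | Rgt => Lft end.

Section Walker.
Variables (A B C Qn Qd : finType).
Local Notation entry := (Qn * sym A * Qn * seq C * dir)%type.
Variables (tab : seq entry) (n0 nf : Qn) (N : nat).
Variables (dlt : Qd -> sym C -> option (Qd * seq B * dir)) (d0 df : Qd).

Definition tab_step p (s : sym A) q (o : seq C) (e : dir) := (p, s, q, o, e) \in tab.

Hypothesis tab_final : forall s q o e, ~ tab_step nf s q o e.
Hypothesis dlt_final : forall s, dlt df s = None.

(* A visit of a cell: the state and a number distinguishing the visits of that
   cell in this state. *)
Definition visit := (Qn * 'I_N.+1)%type.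

(* For each visit of a cell, the instruction that is executed with the number of the
   resulting visit, and the preceding visit with the move leading from it. *)
Definition label := ({ffun visit -> option (seq_sub tab * 'I_N.+1)} *
                     {ffun visit -> option (visit * dir)})%type.
Definition letter := (sym A * label)%type.

Definition next (x : letter) (v : visit) : option (visit * seq C * dir) :=
  if x.2.1 v is Some (en, c) then
    let: (p, s, q, o, e) := val en in
    if (p == v.1) && (s == x.1) then Some ((q, c), o, e) else None
  else None.

Definition prev (x : letter) (v : visit) := x.2.2 v.

Definition written x v : seq C := if next x v is Some (_, o, _) then o else [::].

(* The part of the marked intermediate word that is written during a visit. *)
Definition chunk x v : seq (sym C) :=
  (if prev x v is None then [:: LM] else [::]) ++ map (@Sy C) (written x v) ++
  (if v.1 == nf then [:: RM] else [::]).

(** The two extra symbols leave room for the end markers, both of which may occur in one chunk. *)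
Definition max_chunk := (\max_(en <- tab) size en.1.2).+2.

Lemma size_chunk x v : size (chunk x v) <= max_chunk.
Proof.
suff H : size (written x v) <= \max_(en <- tab) size en.1.2.
  rewrite /chunk !size_cat size_map /max_chunk.
  by case: prev => [?|]; case: (v.1 == nf) => /=; lia.
rewrite /written /next; case: (x.2.1 v) => // -[en c].
case: en => [[[[[p s] q] o] e] He] /=; case: ifP => // _.
exact: (leq_bigmax_seq (p, s, q, o, e) (F := fun en : entry => size en.1.2) He isT).
Qed.

Lemma nextP x v v' o e : next x v = Some (v', o, e) -> tab_step v.1 x.1 v'.1 o e.
Proof.
rewrite /next; case: (x.2.1 v) => // -[[[[[[p s] q] o'] e'] He] c] /=.
by case: ifP => // /andP[/eqP<- /eqP<-] [<- <- <-].
Qed.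

Lemma next_final x v : v.1 = nf -> next x v = None.
Proof.
by move=> E; case D : next => [[[v' o] e]|] //; case/nextP: D; rewrite E => /tab_final.
Qed.

(* The walker first follows the [next] pointers, checking the [prev] pointers, up to
   the final state [nf] ([Ahead]), returns along the [prev] pointers ([Back]), and then
   simulates the second machine ([Sim]), whose head is at the [k]-th symbol of the
   current chunk, with [None] standing for the last one. *)
Definition state :=
  (((visit * option (visit * dir)) + visit) +
   (visit * option 'I_max_chunk.+2 * Qd) + unit)%type.
Definition Ahead v from : state := inl (inl (inl (v, from))).
Definition Back v : state := inl (inl (inr v)).
Definition Sim v k p : state := inl (inr (v, k, p)).
Definition Done : state := inr tt.

(** Local positions range from 0 to [max_chunk.+1], where 0 and the successor of the chunk length
    mean that the chunk has been left. With [None] a chunk is entered from the right before its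
    length is known. *)
Definition local_pos n (k : option 'I_max_chunk.+2) : nat := if k is Some k' then k' else n.

(** In phase [Sim], at local position 0 or just past the chunk the walker moves to the preceding or
    following visit and enters that chunk at its last or first symbol; elsewhere it accepts or
    simulates one step of the second machine. The left marker is only read when starting. *)
Definition walk (st : state) (s : sym letter) : option (state * seq B * dir) :=
  match st, s with
  | inl (inl (inl (v, from))), LM =>
      if from is None then Some (Ahead v None, [::], Rgt) else None
  | inl (inl (inl (v, from))), Sy x =>
      if prev x v == from then
        if v.1 == nf then Some (Back v, [::], Stay)
        else if next x v is Some (v', o, e) then Some (Ahead v' (Some (v, e)), [::], e)
        else None
      else None
  | inl (inl (inr v)), Sy x =>
      if prev x v is Some (v', e) then Some (Back v', [::], opposite e)
      else Some (Sim v (Some (inord 1)) d0, [::], Stay)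
  | inl (inr (v, kp, p)), Sy x =>
      let ch := chunk x v in let k := local_pos (size ch) kp in
      if k == 0 then
        if prev x v is Some (v', e) then Some (Sim v' None p, [::], opposite e) else None
      else if k == (size ch).+1 then
        if next x v is Some (v', _, e) then Some (Sim v' (Some (inord 1)) p, [::], e)
        else None
      else if p == df then Some (Done, [::], Stay)
      else if dlt p (cell ch k) is Some (p', o, e) then
        Some (Sim v (Some (inord (mv e k))) p', o, Stay)
      else None
  | _, _ => None
  end.

(** * Runs of the walker on a labelled word *)

Section Word.
Variables (w : seq A) (y : seq letter).
Hypothesis yw : map fst y = marked w.

Local Notation wrun := (srun (table_step walk) (marked y)).
Local Notation drun := (srun (table_step dlt)).

Lemma size_y : size y = size (marked w).
Proof. by rewrite -yw size_map. Qed.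

Lemma size_y_gt0 : 0 < size y.
Proof. by rewrite size_y. Qed.

Definition blank : letter := (LM, ([ffun=> None], [ffun=> None])).
Definition ycell i := nth blank y i.-1.
Definition inb i := 0 < i <= size y.

Lemma ycell_sym i : inb i -> (ycell i).1 = cell (marked w) i.
Proof. by move=> ib; rewrite /ycell /cell -yw (nth_map blank) //; move: ib; rewrite /inb; lia. Qed.

Lemma size_marked (D : Type) (u : seq D) : size (marked u) = (size u).+2.
Proof. by rewrite /marked /= size_cat size_map addn1. Qed.

(** The walker's tape puts its own markers around [y], which is already a labelled copy of
    [marked w]; hence the shift by one. *)
Lemma cell_y i : inb i -> cell (marked y) i.+1 = Sy (ycell i).
Proof.
case: i => // i; rewrite /inb /cell /marked /ycell /= => ib.
by rewrite nth_cat size_map ib (nth_map blank).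
Qed.

Lemma cell_marked_out i : 0 < i <= size (marked y) -> ~~ inb i.-1 ->
  cell (marked y) i = LM /\ i = 1 \/ cell (marked y) i = RM.
Proof.
rewrite size_marked /inb /cell /marked; case: i => [|[|i]] //= ib nib; first by left.
right; rewrite nth_cat size_map ifF; last lia.
by have -> : i - size y = 0 by lia.
Qed.

Definition node := (visit * nat)%type.
Definition nnext (a : node) := next (ycell a.2) a.1.
Definition nprev (a : node) := prev (ycell a.2) a.1.
Definition nwritten (a : node) := written (ycell a.2) a.1.
Definition nchunk (a : node) := chunk (ycell a.2) a.1.

(** Requiring the back pointer to match gives every visit at most one predecessor, so following
    [prev] from the end of a path retraces that path. *)
Definition edge (a b : node) :=
  if nnext a is Some (v', o, e) then
    [&& b == (v', mv e a.2), inb b.2 & nprev b == Some (a.1, e)]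
  else false.

Lemma edgeP a b : edge a b -> exists e, [/\ nnext a = Some (b.1, nwritten a, e),
  b.2 = mv e a.2, inb b.2 & nprev b = Some (a.1, e)].
Proof.
rewrite /edge /nwritten /written -/(nnext a); case D: (nnext a) => [[[v' o] e]|] //.
by case/and3P => /eqP-> ib /eqP Ep; exists e.
Qed.

Lemma edge_back (a b : node) e : inb a.2 -> b.2 = mv e a.2 -> mv (opposite e) b.2.+1 = a.2.+1.
Proof. by move=> ib ->; move: ib; rewrite /inb; case: e => /=; lia. Qed.

Lemma mvS e i : inb i -> mv e i.+1 = (mv e i).+1.
Proof. by rewrite /inb; case: e => /=; lia. Qed.

Definition root : node := ((n0, ord0), 1).

Definition good s :=
  [/\ nprev root = None, path edge root s & (last root s).1.1 = nf].

Lemma wstep st i o st' e tr c : inb i -> walk st (Sy (ycell i)) = Some (st', o, e) ->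
  wrun (st', mv e i.+1) tr c -> wrun (st, i.+1) ((st, i.+1, o) :: tr) c.
Proof.
move=> ib D r; apply: srunS r; last by rewrite /table_step cell_y.
by move: ib; rewrite size_marked /inb; lia.
Qed.

(** Outside [y] the walker is stuck, except in a state [Ahead v None] on the left marker; any other
    run that is to reach [Done] must read a letter of [y] next. *)
Lemma wrun_inv st i tr j : wrun (st, i.+1) tr (Done, j) -> st <> Done ->
  (forall v, st <> Ahead v None) \/ i <> 0 ->
  inb i /\ exists st' o e tr', [/\ walk st (Sy (ycell i)) = Some (st', o, e),
     wrun (st', mv e i.+1) tr' (Done, j) & tr = (st, i.+1, o) :: tr'].
Proof.
move=> r nd nl; inversion r as [|? ? st' o e tr' ? ib D r']; subst => //.
have ibi : inb i.
  apply: contraT => nib; have [] := cell_marked_out ib nib.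
    case=> E [i0]; case: nl => [nl|//]; move: D; rewrite /table_step E /walk.
    by case: (st) nl => [[[[v [f|]]|]|[[]]]|] // nl; case: (nl v).
  by move=> E; move: D; rewrite /table_step E; case: (st) => [[[[]|]|[[]]]|].
split=> //; exists st', o, e, tr'; split=> //.
by move: D; rewrite /table_step cell_y.
Qed.

Section Path.
Variable s : seq node.
Hypothesis gs : good s.

Let xs := root :: s.
Let nd j := nth root xs j.

Lemma nd_edge j : j.+1 < size xs -> edge (nd j) (nd j.+1).
Proof. by case: gs => _ /(pathP root) H _; exact: H. Qed.

Lemma nd_inb j : j < size xs -> inb (nd j).2.
Proof.
case: j => [_|j lt]; first by rewrite /inb /= size_y_gt0.
by have [e [_ _ ib _]] := edgeP (nd_edge lt).
Qed.

Lemma nd_last : (nd (size s)).1.1 = nf.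
Proof. by case: gs => _ _ <-; rewrite /nd /xs -last_nth. Qed.

Lemma nd_next j : j < size xs -> nnext (nd j) <> None -> j.+1 < size xs.
Proof.
rewrite /xs /= !ltnS leq_eqVlt => /orP[/eqP->|//].
by rewrite /nnext next_final // nd_last.
Qed.

Definition dtape := flatten (map nchunk xs).
Definition offset j := size (flatten (map nchunk (take j xs))).

Lemma offsetS j : j < size xs -> offset j.+1 = offset j + size (nchunk (nd j)).
Proof.
by move=> lt; rewrite /offset (take_nth root lt) map_rcons flatten_rcons size_cat.
Qed.

Lemma cell_dtape j k : j < size xs -> 0 < k <= size (nchunk (nd j)) ->
  cell dtape (offset j + k) = cell (nchunk (nd j)) k.
Proof.
move=> lt /andP[k0 kb]; rewrite /dtape -(cat_take_drop j xs) map_cat flatten_cat.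
by rewrite (drop_nth root lt) /offset cell_catr //= cell_catl // k0.
Qed.

Lemma offset_le j k : j < size xs -> k <= size (nchunk (nd j)) -> offset j + k <= size dtape.
Proof.
move=> lt kb; rewrite /dtape -(cat_take_drop j xs) map_cat flatten_cat size_cat leq_add2l.
by rewrite (drop_nth root lt) /= size_cat; apply: leq_trans kb (leq_addr _ _).
Qed.

Lemma size_dtape : size dtape = offset (size xs).
Proof. by rewrite /offset take_size. Qed.

Lemma local_one n : local_pos n (Some (inord 1)) = 1.
Proof. by rewrite /= inordK. Qed.

Lemma wrun_done i tr c : wrun (Done, i) tr c -> tr = [::].
Proof.
move=> r; inversion r as [|? ? st' o e tr' ? ib D r']; subst => //.
Qed.

(** The invariant is that the second head stands at [offset j] plus the local position. The
    induction is on the walker's run, as its passages between chunks are not steps of the second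
    machine. *)
Lemma sim_sound j k p tr i : j < size xs ->
  local_pos (size (nchunk (nd j))) k <= (size (nchunk (nd j))).+1 ->
  wrun (Sim (nd j).1 k p, (nd j).2.+1) tr (Done, i) ->
  exists2 trd, outs trd = outs tr & exists2 l, 0 < l <= size dtape &
    drun dtape (p, offset j + local_pos (size (nchunk (nd j))) k) trd (df, l).
Proof.
have [n] := ubnP (size tr); elim: n j k p tr => // n IH j k p tr sz lt kb r.
have [||ib [st' [o [e [tr' [D r' Et]]]]]] := wrun_inv r; [by [] | by left | ].
rewrite {}Et {r} in sz *; have {}sz : size tr' < n := sz.
move: D; rewrite /= -/(nchunk (nd j)) -/(nprev (nd j)) -/(nnext (nd j)).
set m := size (nchunk (nd j)) in kb *; set kk := local_pos m k in kb *.
case: eqP => [k0|/eqP k0].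
  case: j lt ib r' @m @kk kb k0 => [|j] lt ib r' m kk kb k0; first by case: gs => ->.
  have [e' [_ Ee _ ->]] := edgeP (nd_edge lt).
  move=> [E1 E2 E3]; rewrite -{}E1 -{}E2 -{}E3 (edge_back (nd_inb (ltnW lt)) Ee) in r' *.
  have [//|trd E r2] := IH _ _ _ _ sz (ltnW lt) _ r'.
  exists trd => //; move: r2; rewrite k0 addn0 offsetS //; exact: ltnW.
case: eqP => [km|/eqP km].
  case D: (nnext (nd j)) => [[[v' o'] e']|] // [E1 E2 E3].
  have lt' : j.+1 < size xs by apply: nd_next; rewrite ?D.
  have [e2 [D2 Ee _ _]] := edgeP (nd_edge lt'); move: D2; rewrite D => -[Ev _ Ee2].
  rewrite -{}E1 -{}E2 -{}E3 mvS // Ee2 -Ee Ev in r' *.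
  have [|trd E r2] := IH _ _ _ _ sz lt' _ r'; first by rewrite local_one.
  exists trd => //; move: r2; rewrite local_one km offsetS // -/m.
  by have -> : offset j + m + 1 = offset j + m.+1 by lia.
have kin : 0 < kk <= m by lia.
case: eqP => [->|_].
  move=> [E1 E2 E3]; rewrite -{}E1 in r'; rewrite (wrun_done r') -E2.
  exists [::] => //; exists (offset j + kk); last exact: srun0.
  by have := offset_le lt (proj2 (andP kin)); lia.
case D: (dlt p _) => [[[p' o'] e']|] // [E1 E2 E3].
have mm : mv e' kk <= m.+1 by case: (e') => /=; lia.
have El : local_pos m (Some (inord (mv e' kk))) = mv e' kk.
  by rewrite /= inordK // ltnS (leq_trans mm) // ltnS size_chunk.
rewrite -{}E1 -{}E3 /= in r'.
have [|trd E [l lb r2]] := IH _ _ _ _ sz lt _ r'; first by rewrite -/m El.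
exists ((p, offset j + kk, o') :: trd); first by rewrite -E2 /outs /=; congr cat.
exists l => //; apply: (srunS (e := e')).
- by have := offset_le lt (proj2 (andP kin)); lia.
- by rewrite /table_step cell_dtape //; exact: D.
- have -> : mv e' (offset j + kk) = offset j + mv e' kk by case: (e') => /=; lia.
  by move: r2; rewrite -/m El.
Qed.

(** Chunks may be empty, so several silent passages along the pointers may be needed before the
    current chunk contains the position of the second head. *)
Lemma sim_settle j k p : j < size xs ->
  local_pos (size (nchunk (nd j))) k <= (size (nchunk (nd j))).+1 ->
  0 < offset j + local_pos (size (nchunk (nd j))) k <= size dtape ->
  exists j' k' tr, [/\ j' < size xs,
    0 < local_pos (size (nchunk (nd j'))) k' <= size (nchunk (nd j')),
    offset j' + local_pos (size (nchunk (nd j'))) k' =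
      offset j + local_pos (size (nchunk (nd j))) k,
    wrun (Sim (nd j).1 k p, (nd j).2.+1) tr (Sim (nd j').1 k' p, (nd j').2.+1)
    & outs tr = [::]].
Proof.
move=> lt kb gb.
have [k0|k0] := posnP (local_pos (size (nchunk (nd j))) k).
  elim: j k lt kb gb k0 => [|j IH] k lt kb gb k0; first by move: gb; rewrite k0.
  have [e' [_ Ee _ Ep]] := edgeP (nd_edge lt).
  have lt' := ltnW lt.
  have st tr c : wrun (Sim (nd j).1 None p, (nd j).2.+1) tr c ->
     wrun (Sim (nd j.+1).1 k p, (nd j.+1).2.+1) ((Sim (nd j.+1).1 k p, (nd j.+1).2.+1, [::]) :: tr) c.
    rewrite -(edge_back (nd_inb lt') Ee); apply: wstep; first exact: nd_inb.
    by rewrite /= -/(nchunk (nd j.+1)) k0 /= -/(nprev (nd j.+1)) Ep.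
  have Eo : offset j.+1 + 0 = offset j + size (nchunk (nd j)) by rewrite addn0 offsetS.
  rewrite k0 Eo in gb *.
  have [m0|m0] := posnP (size (nchunk (nd j))).
    have [//|//|//|j' [k' [tr [? ? E r' E']]]] := IH None lt'.
    by exists j', k', ((Sim (nd j.+1).1 k p, (nd j.+1).2.+1, [::]) :: tr); split=> //; exact: st.
  exists j, None, [:: (Sim (nd j.+1).1 k p, (nd j.+1).2.+1, [::])]; split=> //.
    by rewrite /= m0 leqnn.
  by apply: st; exact: srun0.
have [km|km] := leqP (local_pos (size (nchunk (nd j))) k) (size (nchunk (nd j))).
  by exists j, k, [::]; split=> //; [rewrite k0 | exact: srun0].
have {kb km k0} Ek : local_pos (size (nchunk (nd j))) k = (size (nchunk (nd j))).+1 by lia.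
move En : (size xs - j) => n.
elim: n j k En lt gb Ek => [|n IH] j k En lt gb Ek; first by lia.
(* Past the last chunk the position would exceed [size dtape], so there is a following visit. *)
have lt' : j.+1 < size xs.
  rewrite ltn_neqAle lt andbT; apply/eqP => E; move: gb.
  by rewrite size_dtape -E offsetS // Ek; lia.
have [e' [En' Ee _ _]] := edgeP (nd_edge lt').
have st tr c : wrun (Sim (nd j.+1).1 (Some (inord 1)) p, (nd j.+1).2.+1) tr c ->
   wrun (Sim (nd j).1 k p, (nd j).2.+1) ((Sim (nd j).1 k p, (nd j).2.+1, [::]) :: tr) c.
  rewrite Ee -mvS ?nd_inb //; apply: wstep; first exact: nd_inb.
  by rewrite /= -/(nchunk (nd j)) Ek /= eqxx -/(nnext (nd j)) En'.
have Eo : offset j + (size (nchunk (nd j))).+1 = offset j.+1 + 1 by rewrite offsetS; lia.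
rewrite Ek Eo in gb *.
have [m0|m0] := posnP (size (nchunk (nd j.+1))).
  have [||||j' [k' [tr [? ? E r' E']]]] := IH j.+1 (Some (inord 1)).
  - by lia.
  - by [].
  - by rewrite local_one.
  - by rewrite local_one m0.
  rewrite local_one in E.
  by exists j', k', ((Sim (nd j).1 k p, (nd j).2.+1, [::]) :: tr); split=> //; exact: st.
exists j.+1, (Some (inord 1)), [:: (Sim (nd j).1 k p, (nd j).2.+1, [::])].
by rewrite local_one; split=> //; apply: st; exact: srun0.
Qed.

Lemma sim_complete c trd c' : drun dtape c trd c' -> c'.1 = df -> 0 < c'.2 <= size dtape ->
  forall j k, j < size xs ->
  local_pos (size (nchunk (nd j))) k <= (size (nchunk (nd j))).+1 ->
  c.2 = offset j + local_pos (size (nchunk (nd j))) k ->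
  exists2 i, 0 < i <= size (marked y) &
  exists2 tr, wrun (Sim (nd j).1 k c.1, (nd j).2.+1) tr (Done, i) & outs tr = outs trd.
Proof.
have inm j : j < size xs -> 0 < (nd j).2.+1 <= size (marked y).
  by move=> lt; have := nd_inb lt; rewrite size_marked /inb; lia.
elim=> {c trd c'} [c Ec cb j k lt kb Eg|p g q o e trd c gb D r IH /= Ec cb j k lt kb Eg].
  rewrite Eg in cb; have [j' [k' [tr [lt' kb' E r Eo]]]] := sim_settle c.1 lt kb cb.
  exists (nd j').2.+1; first exact: inm.
  exists (tr ++ [:: (Sim (nd j').1 k' c.1, (nd j').2.+1, [::])]); last by rewrite outs_cat Eo.
  apply: srun_cat r _; apply: (wstep (e := Stay)); first exact: nd_inb.
    rewrite /= -/(nchunk (nd j')) Ec eqxx.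
    by rewrite ifF; last lia; rewrite ifF //; lia.
  exact: srun0.
rewrite Eg in gb D IH; have [j' [k' [tr [lt' kb' E r' Eo]]]] := sim_settle p lt kb gb.
rewrite -E in gb D r IH.
set m := size (nchunk (nd j')) in kb' E D r gb IH *.
set kk := local_pos m k' in kb' E D r gb IH *.
have mm : mv e kk <= m.+1 by case: (e) => /=; lia.
have El : local_pos m (Some (inord (mv e kk))) = mv e kk.
  by rewrite /= inordK // ltnS (leq_trans mm) // ltnS size_chunk.
have Em : mv e (offset j' + kk) = offset j' + mv e kk by case: (e) => /=; lia.
have [||i ib [tr2 r2 E2]] := IH Ec cb j' (Some (inord (mv e kk))) lt'.
- by rewrite -/m El.
- by rewrite -/m El -Em.
exists i => //; exists (tr ++ (Sim (nd j').1 k' p, (nd j').2.+1, o) :: tr2).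
  apply: srun_cat r' _; apply: (wstep (e := Stay)) r2; first exact: nd_inb.
  rewrite /= -/(nchunk (nd j')) -/m -/kk ifF; last lia.
  rewrite ifF; last lia.
  rewrite ifF; last by apply/eqP => Ep; move: D; rewrite Ep /table_step dlt_final.
  by rewrite cell_dtape // in D; rewrite D.
by rewrite outs_cat Eo /outs /= -!/(outs _) E2.
Qed.

Lemma walk_back (a : node) : walk (Back a.1) (Sy (ycell a.2)) =
  if nprev a is Some (v', e) then Some (Back v', [::], opposite e)
  else Some (Sim a.1 (Some (inord 1)) d0, [::], Stay).
Proof. by []. Qed.

Lemma back_sound j tr i : j < size xs -> wrun (Back (nd j).1, (nd j).2.+1) tr (Done, i) ->
  exists2 tr', wrun (Sim root.1 (Some (inord 1)) d0, root.2.+1) tr' (Done, i) & outs tr = outs tr'.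
Proof.
elim: j tr => [|j IH] tr lt r.
  have [||ib [st' [o [e [tr' [D r' ->]]]]]] := wrun_inv r; [by [] | by left | ].
  move: D; rewrite walk_back; case: gs => -> _ _ [E1 <- E3].
  by rewrite -E1 -E3 in r'; exists tr'.
have [||ib [st' [o [e [tr' [D r' ->]]]]]] := wrun_inv r; [by [] | by left | ].
have [e' [_ Ee _ Ep]] := edgeP (nd_edge lt).
move: D; rewrite walk_back Ep => -[E1 <- E3].
rewrite -{}E1 -{}E3 (edge_back (nd_inb (ltnW lt)) Ee) in r'.
by have [tr2 ? ?] := IH _ (ltnW lt) r'; exists tr2.
Qed.

Lemma back_complete j : j < size xs -> exists2 tr,
  wrun (Back (nd j).1, (nd j).2.+1) tr (Sim root.1 (Some (inord 1)) d0, root.2.+1) & outs tr = [::].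
Proof.
elim: j => [|j IH] lt.
  exists [:: (Back (nd 0).1, (nd 0).2.+1, [::])] => //.
  apply: (wstep (e := Stay)); [exact: nd_inb | | exact: srun0].
  by rewrite walk_back; case: gs => ->.
have [e' [_ Ee _ Ep]] := edgeP (nd_edge lt).
have [tr r Eo] := IH (ltnW lt).
exists ((Back (nd j.+1).1, (nd j.+1).2.+1, [::]) :: tr) => //.
rewrite -(edge_back (nd_inb (ltnW lt)) Ee) in r; apply: wstep r; first exact: nd_inb.
by rewrite walk_back Ep.
Qed.

Lemma ahead_complete j : j < size xs -> exists2 tr,
  wrun (Ahead (nd j).1 (nprev (nd j)), (nd j).2.+1) tr
    (Back (nd (size s)).1, (nd (size s)).2.+1) & outs tr = [::].
Proof.
move En : (size xs - j.+1) => n; elim: n j En => [|n IH] j En lt.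
  have -> : j = size s by move: En lt; rewrite /xs /=; lia.
  exists [:: (Ahead (nd (size s)).1 (nprev (nd (size s))), (nd (size s)).2.+1, [::])] => //.
  apply: (wstep (e := Stay)); [exact: nd_inb | | exact: srun0].
  by rewrite /= eqxx nd_last eqxx.
have lt' : j.+1 < size xs by lia.
have [e' [En' Ee _ Ep]] := edgeP (nd_edge lt').
have [|tr r Eo] := IH j.+1 _ lt'; first by lia.
exists ((Ahead (nd j).1 (nprev (nd j)), (nd j).2.+1, [::]) :: tr) => //.
rewrite Ee -mvS ?nd_inb // Ep in r; apply: wstep r; first exact: nd_inb.
rewrite /= eqxx -/(nnext (nd j)) En' ifF //.
by apply/eqP => E; move: En'; rewrite /nnext next_final.
Qed.

(** On the path only the root lacks a predecessor and only the last visit is in state [nf], so each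
    end marker is contributed once, at the proper end. *)
Lemma dtapeE : dtape = marked (flatten (map nwritten (belast root s))).
Proof.
have chunks a s' : path edge a s' -> (last a s').1.1 = nf -> flatten (map nchunk (a :: s')) =
    (if nprev a is None then [:: LM] else [::]) ++
    map (@Sy C) (flatten (map nwritten (belast a s'))) ++ [:: RM].
  elim: s' a => [|b s' IH] a.
    by move=> _ /= E; rewrite cats0 /nchunk /chunk /written next_final // E eqxx.
  rewrite /= => /andP[/edgeP[e [D _ _ Ep]] ps] El.
  have /= -> := IH b ps El; rewrite Ep /nchunk /chunk -/(nprev a) -/(nwritten a).
  have -> : (a.1.1 == nf) = false.
    by apply/eqP => E; move: D; rewrite /nnext next_final.
  by rewrite cats0 map_cat -!catA.
by case: gs => g1 g2 g3; rewrite /dtape chunks // g1.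
Qed.

Lemma path_accepts : exists2 tr, accepts tab_step n0 nf (marked w) tr &
  outs tr = flatten (map nwritten (belast root s)).
Proof.
have runs a s' : path edge a s' -> inb a.2 ->
    exists2 tr, srun tab_step (marked w) (a.1.1, a.2) tr ((last a s').1.1, (last a s').2)
      & outs tr = flatten (map nwritten (belast a s')).
  elim: s' a => [|b s' IH] a /=; first by exists [::] => //; exact: srun0.
  case/andP => /edgeP[e [D Eb bb _]] /IH /(_ bb) [tr r E] ab.
  exists ((a.1.1, a.2, nwritten a) :: tr); last by rewrite /outs /=; congr cat.
  apply: (srunS (e := e)) (_ : srun _ _ (b.1.1, _) _ _); first by rewrite -size_y.
    by rewrite -ycell_sym //; exact: nextP D.
  by rewrite -Eb.
case: gs => g1 g2 g3.
have [|tr r E] := runs root s g2; first by rewrite /inb size_y_gt0.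
exists tr => //; exists (last root s).2; last by rewrite -g3.
have := @nd_inb (size s) (ltnSn _); rewrite /nd /xs -last_nth /inb size_y; exact.
Qed.

End Path.

Lemma path_inb s : path edge root s -> inb (last root s).2.
Proof.
case/lastP: s => [_|s b]; first by rewrite /inb size_y_gt0.
by rewrite rcons_path last_rcons => /andP[_ /edgeP[e []]].
Qed.

Lemma walk_ahead (a : node) from : walk (Ahead a.1 from) (Sy (ycell a.2)) =
  if nprev a == from then
    if a.1.1 == nf then Some (Back a.1, [::], Stay)
    else if nnext a is Some (v', o, e) then Some (Ahead v' (Some (a.1, e)), [::], e)
    else None
  else None.
Proof. by []. Qed.

Lemma ahead_sound s tr l : nprev root = None -> path edge root s ->
  wrun (Ahead (last root s).1 (nprev (last root s)), (last root s).2.+1) tr (Done, l) ->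
  exists s' tr', [/\ good s',
    wrun (Back (last root s').1, (last root s').2.+1) tr' (Done, l) & outs tr = outs tr'].
Proof.
move=> p0; have [n] := ubnP (size tr); elim: n s tr => // n IH s tr sz ps r.
have ib := path_inb ps.
have [||_ [st' [o [e [tr' [D r' Et]]]]]] := wrun_inv r; first by [].
  by right; move: ib; rewrite /inb; case: (_.2).
rewrite {}Et {r} in sz *; have {}sz : size tr' < n := sz.
move: D; rewrite walk_ahead eqxx.
case: eqP => [Ef [E1 <- E3]|_]; first by rewrite -E1 -E3 in r'; exists s, tr'.
case D: nnext => [[[v' o'] e']|] // [E1 <- E3].
rewrite -{}E1 -{}E3 mvS // in r'.
pose b : node := (v', mv e' (last root s).2).
(* The pointer from [b] back to the present visit is checked only in the next step, which has to be
   inspected before the path can be extended. *)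
have [||ibb [st2 [o2 [e2 [tr2 [D2 _ _]]]]]] := wrun_inv r'; [by [] | by left | ].
have pb : nprev b = Some ((last root s).1, e').
  by move: D2; rewrite (walk_ahead b); case: eqP.
have eb : edge (last root s) b by rewrite /edge D eqxx ibb pb eqxx.
have [||s' [t' [? ? E]]] := IH (rcons s b) tr' sz.
- by rewrite rcons_path ps.
- by rewrite last_rcons pb.
by exists s', t'.
Qed.

Lemma walk_sound tr : accepts (table_step walk) (Ahead root.1 None) Done (marked y) tr ->
  exists s trd, [/\ good s, accepts (table_step dlt) d0 df (dtape s) trd & outs trd = outs tr].
Proof.
case=> l lb r; inversion r as [|? ? st' o e tr' ? ib D r']; subst.
move: D; rewrite /table_step {1}/cell /= => -[E1 <- E3]; subst st' e.
have [||ib1 [st2 [o2 [e2 [tr2 [D2 _ _]]]]]] := wrun_inv r'; [by [] | by right | ].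
have p0 : nprev root = None by move: D2; rewrite (walk_ahead root); case: eqP.
have [||s [tr3 [gs r3 E3]]] := @ahead_sound [::] tr' l p0; first by [].
  by rewrite /= p0.
have {r3} r3 : wrun (Back (nth root (root :: s) (size s)).1, (nth root (root :: s) (size s)).2.+1) tr3 (Done, l).
  by rewrite -last_nth.
have [tr4 r4 E4] := back_sound gs (ltnSn _) r3.
have [|trd E5 [l' lb' r5]] := sim_sound gs (ltn0Sn _) _ r4; first by rewrite local_one.
exists s, trd; split=> //; last by rewrite E5 -E4 -E3.
by exists l' => //; move: r5; rewrite local_one.
Qed.

Lemma walk_complete s trd : good s -> accepts (table_step dlt) d0 df (dtape s) trd ->
  exists2 tr, accepts (table_step walk) (Ahead root.1 None) Done (marked y) tr & outs tr = outs trd.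
Proof.
move=> gs [l lb r].
have [tr1 r1 E1] := ahead_complete gs (ltn0Sn _).
have [tr2 r2 E2] := back_complete gs (ltnSn _).
have [||i ib [tr3 r3 E3]] := sim_complete gs r erefl lb (j := 0) (k := Some (inord 1)) (ltn0Sn _).
- by rewrite local_one.
- by rewrite local_one.
have p0 : nprev root = None by case: gs.
exists ((Ahead root.1 None, 1, [::]) :: tr1 ++ tr2 ++ tr3).
  exists i => //; apply: (srunS (e := Rgt)) (_ : srun _ _ (Ahead root.1 None, _) _ _) => //.
  by rewrite /= p0 in r1; exact: srun_cat r1 (srun_cat r2 r3).
by rewrite /outs /= -/(outs _) !outs_cat E1 E2 E3.
Qed.

End Word.

(** * Labelling a run with few visits *)

Section Labelling.
Variables (w : seq A) (tr : seq (Qn * nat * seq C)) (i : nat).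
Hypothesis ib : 0 < i <= size (marked w).
Hypothesis run : srun tab_step (marked w) (n0, 1) tr (nf, i).
Hypothesis few_visits : forall c, count (fun x => x.1 == c) tr <= N.

Let cs := rcons (map fst tr) (nf, i).
Let conf t := nth (nf, i) cs t.
Let out t := nth [::] (map snd tr) t.
(** Visits of a configuration are numbered by its earlier occurrences. For [t <= size tr] these all
    lie in [tr], so [few_visits] keeps the number at most [N] and [inord] does not change it. *)
Let id t : 'I_N.+1 := inord (count (pred1 (conf t)) (take t cs)).
Let nd t : node := ((conf t).1, id t, (conf t).2).
Let xs := mkseq nd (size tr).+1.
Let exec t e : entry := ((conf t).1, cell (marked w) (conf t).2, (conf t.+1).1, out t, e).
(** A trace does not record the moves of the head, so a move that fits both the table and the next
    position is picked. *)
Let dirn t := odflt Stay [pick e | (exec t e \in tab) && (mv e (conf t).2 == (conf t.+1).2)].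

Let size_cs : size cs = (size tr).+1.
Proof. by rewrite size_rcons size_map. Qed.

Let confE t : t < size tr -> [/\ 0 < (conf t).2 <= size (marked w),
  exec t (dirn t) \in tab & mv (dirn t) (conf t).2 = (conf t.+1).2].
Proof.
move=> lt; suff [e [b1 b2 b3]] : exists e, [/\ 0 < (conf t).2 <= size (marked w),
    exec t e \in tab & mv e (conf t).2 = (conf t.+1).2].
  rewrite /dirn; case: pickP => [e' /andP[? /eqP ?] //|/(_ e)].
  by rewrite b2 b3 eqxx.
by have [_ /(_ t lt)] := srun_nth (nf, i) run.
Qed.

Let count_le t : t <= size tr -> count (pred1 (conf t)) (take t cs) <= N.
Proof.
move=> lt; apply: leq_trans (few_visits (conf t)).
rewrite /cs -cats1 takel_cat ?size_map // -map_take count_map.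
by rewrite -{2}(cat_take_drop t tr) count_cat; apply: leq_addr.
Qed.

(** At a later occurrence of the same configuration the earlier one is counted too, so the numbers
    differ. *)
Let uniq_xs : uniq xs.
Proof.
apply/mkseq_uniqP => s t; rewrite !inE !ltnS => sb tb E.
wlog lt : s t sb tb E / s < t.
  by move=> H; case: (ltngtP s t) => // lt; [exact: H | apply/esym/H].
have Ec : conf s = conf t.
  by case: E => E1 _ E2; rewrite [conf s]surjective_pairing [conf t]surjective_pairing E1 E2.
case: E => _ /(congr1 val) /=; rewrite !inordK ?ltnS ?count_le // -Ec => E _.
have : count (pred1 (conf s)) (take s.+1 cs) <= count (pred1 (conf s)) (take t cs).
  by rewrite -(cat_take_drop s.+1 (take t cs)) count_cat take_takel // leq_addr.
by rewrite (take_nth (nf, i)) ?size_cs // -cats1 count_cat -/(conf s) /= eqxx -E addn0 addn1 ltnn.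
Qed.

(** By uniqueness a visit determines its time through [index]. For a visit that does not occur the
    index exceeds [size tr], and it gets no pointers. *)
Let forth l v := let t := index (v, l) xs in
  if t < size tr then omap (fun en => (en, id t.+1)) (insub (exec t (dirn t)) : option (seq_sub tab))
  else None.
Let backw l v := let t := index (v, l) xs in
  if 0 < t <= size tr then Some ((nd t.-1).1, dirn t.-1) else None.
Let y : seq letter := mkseq (fun j => (cell (marked w) j.+1,
  ([ffun v => forth j.+1 v], [ffun v => backw j.+1 v]))) (size (marked w)).

Let yw : map fst y = marked w.
Proof.
rewrite /y /mkseq -map_comp -[RHS](mkseq_nth LM); exact: eq_map.
Qed.

Let size_labelled : size y = size (marked w).
Proof. by rewrite size_mkseq. Qed.

Let ycellE l : 0 < l <= size (marked w) ->
  ycell y l = (cell (marked w) l, ([ffun v => forth l v], [ffun v => backw l v])).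
Proof. by case: l => // l lb; rewrite /ycell /= nth_mkseq. Qed.

Let index_nd t : t <= size tr -> index (nd t) xs = t.
Proof.
move=> lt; rewrite -[nd t](nth_mkseq (nd 0) nd (n := (size tr).+1)) //.
by rewrite index_uniq // size_mkseq.
Qed.

Let conf_inb t : t <= size tr -> 0 < (conf t).2 <= size (marked w).
Proof.
rewrite leq_eqVlt => /orP[/eqP->|/confE[]//].
by rewrite /conf /cs nth_rcons size_map ltnn eqxx.
Qed.

Let nextE t : t < size tr -> nnext y (nd t) = Some ((nd t.+1).1, out t, dirn t).
Proof.
move=> lt; have [lb ex _] := confE lt.
rewrite /nnext ycellE //= /next /= ffunE /forth index_nd ?(ltnW lt) // lt.
by rewrite insubT /= !eqxx.
Qed.

Let edge_nd t : t < size tr -> edge y (nd t) (nd t.+1).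
Proof.
move=> lt; have [lb _ Em] := confE lt; have lb' := conf_inb lt.
rewrite /edge nextE //= Em eqxx /inb size_labelled lb' /=.
by rewrite /nprev ycellE //= /prev /= ffunE /backw index_nd //= lt.
Qed.

Lemma bounded_run_labelled : exists y s,
  [/\ map fst y = marked w, good y s & dtape y s = marked (outs tr)].
Proof.
have root0 : nd 0 = root.
  have E : conf 0 = (n0, 1) by have [] := srun_nth (nf, i) run.
  by rewrite /nd /id E take0 /=; congr (_, _, _); apply: val_inj; rewrite /= inordK.
pose s := mkseq (fun t => nd t.+1) (size tr).
have nthE t : t <= size tr -> nth root (root :: s) t = nd t.
  by case: t => [|t] lt; [rewrite root0 | rewrite /= nth_mkseq].
have gs : good y s.
  split.
  - by rewrite -root0 /nprev ycellE ?conf_inb //= /prev /= ffunE /backw index_nd.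
  - apply/(pathP root) => t; rewrite size_mkseq => lt.
    by rewrite nthE ?(ltnW lt) // nth_mkseq // edge_nd.
  - rewrite (last_nth root) size_mkseq nthE //.
    by rewrite /nd /conf /cs nth_rcons size_map ltnn eqxx.
exists y, s; split=> //; rewrite (dtapeE gs); congr marked.
rewrite /outs; congr flatten.
apply: (@eq_from_nth _ [::]); rewrite ?size_map ?size_belast ?size_mkseq // => t lt.
rewrite (nth_map root) ?size_belast ?size_mkseq //.
have -> : nth root (belast root s) t = nd t.
  by rewrite -(nthE t (ltnW lt)) lastI nth_rcons size_belast size_mkseq lt.
by rewrite /nwritten /written -/(nnext y (nd t)) nextE.
Qed.

End Labelling.
End Walker.

(** * Compositions with finitely many outputs *)

Lemma all2_catP (T1 T2 : Type) (r : T1 -> T2 -> bool) s1 s2 t : all2 r (s1 ++ s2) t ->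
  exists t1 t2, [/\ t = t1 ++ t2, all2 r s1 t1 & all2 r s2 t2].
Proof.
elim: s1 t => [|x s1 IH] t /=; first by exists [::], t.
case: t => // y t /andP[rxy /IH[t1 [t2 [-> r1 r2]]]].
by exists (y :: t1), t2; rewrite /= rxy.
Qed.

Lemma all2_cat_id (T1 T2 : Type) (r : T1 -> T2 -> bool) s1 s2 t1 t2 :
  all2 r s1 t1 -> all2 r s2 t2 -> all2 r (s1 ++ s2) (t1 ++ t2).
Proof.
elim: s1 t1 => [|x s1 IH] [|y t1] //= /andP[-> r1] r2; exact: IH.
Qed.

Lemma eq_accepts (Q C O : Type) (stp1 stp2 : Q -> sym C -> Q -> seq O -> dir -> Prop) q0 qf S tr :
  (forall p s q o e, stp1 p s q o e -> stp2 p s q o e) ->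
  accepts stp1 q0 qf S tr -> accepts stp2 q0 qf S tr.
Proof.
move=> H [i ib r]; exists i => //.
by elim: r => {tr} [c|p l q o e tr c lb /H st _ IH]; [exact: srun0 | exact: srunS st IH].
Qed.

(* Agreement with [m] is only required where the outputs of [m] have bounded length;
   unlike finitariness, this is inherited by the second factor of a composition. *)
Definition MREL_DGSM_on_finite (A B : finType) (m : transduction A B) :=
  exists f : transduction A B, [/\ in_MREL_DGSM f, forall w z, f w z -> m w z &
    forall w K, (forall z, m w z -> size z <= K) -> forall z, m w z -> f w z].

(** The relabelling guesses the labels. Every accepted labelling comes from a genuine run, as the
    walker checks the pointers. Conversely, a bound on the outputs yields by [bounded_visits] a run
    that visits each configuration at most [N] times, and such a run can be labelled. *)
Lemma composed_tables (A B C Qn Qd : finType) (tab : seq (Qn * sym A * Qn * seq C * dir))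
    (n0 nf : Qn) (dlt : Qd -> sym C -> option (Qd * seq B * dir)) (d0 df : Qd) :
  (forall s q o e, ~ tab_step tab nf s q o e) -> (forall s, dlt df s = None) ->
  MREL_DGSM_on_finite (composed (tab_step tab) n0 nf (table_step dlt) d0 df).
Proof.
move=> tabf dltf; pose N := max_visits Qd.
pose R (s : sym A) (x : letter tab N) := s == x.1.
have RP m y : all2 R m y = (map fst y == m).
  by elim: m y => [|s m IH] [|x y] //=; rewrite eqseq_cons -IH [x.1 == s]eq_sym.
pose W : transduction (letter tab N) B := fun y z => exists2 tr,
  accepts (table_step (walk nf dlt d0 df)) (Ahead Qd tab (root n0 N).1 None) (Done Qd tab N) (marked y) tr
  & outs tr = z.
exists (comp (fun w y => relabel R (marked w) y) W); split.
- exists (letter tab N), (fun w y => relabel R (marked w) y), W.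
  split; first by exists R.
  by split; [exact: DGSM_table | ].
- move=> w z [y [/= Ry [tr acc <-]]].
  have yw : map fst y = marked w by apply/eqP; rewrite -RP.
  have [s [trd [gs accd E]]] := walk_sound tabf yw acc.
  have [trn accn En] := path_accepts yw gs.
  by exists trn, trd; split=> //; rewrite En -(dtapeE tabf gs).
- move=> w K bnd z [tr [trd [acc accd Ez]]].
  have df' s q o e : ~ table_step dlt df s q o e by rewrite /table_step dltf.
  have dd p s q o e q' o' e' : table_step dlt p s q o e -> table_step dlt p s q' o' e' ->
      [/\ q = q', o = o' & e = e'] by rewrite /table_step => -> [-> -> ->].
  have [tr' [trd' [[i ib run] acc2 E few]]] := bounded_visits df' dd bnd acc accd.
  have [y [s [yw gs dE]]] := bounded_run_labelled tabf ib run few.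
  rewrite -dE in acc2; have [tr2 acc3 E3] := walk_complete tabf dltf yw gs acc2.
  exists y; split; first by rewrite /relabel RP yw.
  by exists tr2 => //; rewrite E3 E.
Qed.

(** * Transition tables of a given machine *)

Section GsmTable.
Variables (A B : finType) (M : gsm A B).

Definition gsm_entry (t : instr (gQ M) A B) (s : sym A) : gQ M * sym A * gQ M * seq B * dir :=
  if s == isig t then (ip t, s, iq1 t, ia1 t, ie1 t) else (ip t, s, iq0 t, ia0 t, ie0 t).

Definition gsm_table :=
  flatten [seq [seq gsm_entry t s | s <- enum {: sym A}] | t <- gdelta M].

Lemma gsm_tableP p s q o e : tab_step gsm_table p s q o e <-> gsm_step p s q o e.
Proof.
rewrite /tab_step /gsm_table /gsm_step; elim: (gdelta M) => [|t d IH].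
  by split=> // -[t []].
rewrite /= mem_cat; split=> [/orP[/mapP[s' _ E]|/IH[t' [? ? ?]]]|[t' [[->|It] Ep H]]].
- exists t; move: E; rewrite /gsm_entry; case: ifP => c [-> -> -> -> ->]; rewrite c.
    by split=> //; left.
  by split=> //; left.
- by exists t'; split=> //; right.
- apply/orP; left; apply/mapP; exists s; first by rewrite mem_enum.
  by rewrite /gsm_entry -Ep; move: H; case: ifP => _ [-> -> ->].
- by apply/orP; right; apply/IH; exists t'.
Qed.

Lemma gsm_step_final s q o e : ~ gsm_step (gqf M) s q o e.
Proof. by case=> t [/gwf]. Qed.

(** Under determinism all matching entries come from one instruction and agree, so the first one
    represents them all. *)
Definition gsm_delta p s : option (gQ M * seq B * dir) :=
  ohead [seq (x.1.1.2, x.1.2, x.2) | x <- gsm_table & (x.1.1.1.1 == p) && (x.1.1.1.2 == s)].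

Lemma gsm_deltaP : deterministic M -> forall p s q o e,
  table_step gsm_delta p s q o e <-> gsm_step p s q o e.
Proof.
move=> det p s q o e; rewrite /table_step /gsm_delta.
set l := map _ _.
have lP q' o' e' : (q', o', e') \in l <-> gsm_step p s q' o' e'.
  rewrite -gsm_tableP; split.
    case/mapP => -[[[[p1 s1] q1] o1] e1] /=; rewrite mem_filter /= => /andP[/andP[/eqP-> /eqP->] H].
    by move=> [-> -> ->].
  move=> H; apply/mapP; exists (p, s, q', o', e') => //.
  by rewrite mem_filter /= !eqxx.
split=> [E|H]; first by apply/lP; case: (l) E => //= x l' [->]; rewrite mem_head.
have : (q, o, e) \in l by apply/lP.
case El: l => [//|[[q1 o1] e1] l'] _ /=.
have [t1 [I1 E1 H1]] : gsm_step p s q1 o1 e1 by apply/lP; rewrite El mem_head.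
have [t [I E H2]] := H.
have Et : t1 = t by apply: det; rewrite ?E.
by subst t1; move: H1 H2; case: ifP => _ [-> -> ->] [-> -> ->].
Qed.

Lemma gsm_delta_final : deterministic M -> forall s, gsm_delta (gqf M) s = None.
Proof.
move=> det s; case E : gsm_delta => [[[q o] e]|] //.
by case: (@gsm_step_final s q o e); apply/(gsm_deltaP det).
Qed.

Lemma realized_table w z : realized M w z <->
  exists2 tr, accepts (tab_step gsm_table) (gqin M) (gqf M) (marked w) tr & outs tr = z.
Proof.
rewrite realizedE; split=> -[tr a E]; exists tr => //; apply: eq_accepts a => *; exact/gsm_tableP.
Qed.

Lemma realized_delta w z : deterministic M -> realized M w z <->
  exists2 tr, accepts (table_step gsm_delta) (gqin M) (gqf M) (marked w) tr & outs tr = z.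
Proof.
move=> det.
rewrite realizedE; split=> -[tr a E]; exists tr => //; apply: eq_accepts a => *; exact/gsm_deltaP.
Qed.

End GsmTable.

(** * Absorbing a marked relabelling into a nondeterministic machine *)

Section Relabel.
Variables (A C D Q : finType) (tab : seq (Q * sym A * Q * seq C * dir)) (n0 nf : Q).
Variable R : sym C -> D -> bool.

Definition relabellings o : seq (seq D) :=
  [seq o' <- map val (enum {: (size o).-tuple D}) | all2 R (map (@Sy C) o) o'].

Lemma relabellingsP o o' : o' \in relabellings o <-> all2 R (map (@Sy C) o) o'.
Proof.
rewrite mem_filter; split=> [/andP[]//|H]; rewrite H /=.
have sz : size o' == size o by move: H; rewrite all2E size_map eq_sym => /andP[].
by apply/mapP; exists (Tuple sz); rewrite // mem_enum.
Qed.

Local Notation Q' := (bool + Q)%type.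

(* [inl true] is the initial and [inl false] the final state. *)
Definition relabel_table : seq (Q' * sym A * Q' * seq D * dir) :=
  [seq (inl true, s, inr n0, [:: d], Stay) | s <- enum {: sym A}, d <- [seq d <- enum D | R LM d]] ++
  flatten [seq [seq (inr x.1.1.1.1, x.1.1.1.2, inr x.1.1.2, o', x.2) | o' <- relabellings x.1.2] | x <- tab] ++
  [seq (inr nf, s, inl false, [:: d], Stay) | s <- enum {: sym A}, d <- [seq d <- enum D | R RM d]].

Definition relabel_step (x : Q') s (y : Q') o e :=
  match x, y with
  | inl true, inr q => [/\ q = n0, e = Stay & exists2 d, R LM d & o = [:: d]]
  | inr p, inr q => exists2 o0, tab_step tab p s q o0 e & all2 R (map (@Sy C) o0) o
  | inr p, inl false => [/\ p = nf, e = Stay & exists2 d, R RM d & o = [:: d]]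
  | _, _ => False
  end.

Lemma relabel_tableP x s y o e : tab_step relabel_table x s y o e <-> relabel_step x s y o e.
Proof.
rewrite /tab_step /relabel_table !mem_cat; split.
  case/or3P.
  - by case/allpairsP => -[s' d] /= [_]; rewrite mem_filter => /andP[Rd _] [-> -> -> -> ->]; split=> //; exists d.
  - case/flattenP => l /mapP[[[[[p s'] q] o0] e'] xt ->] /mapP[o' /relabellingsP Ro /= [-> -> -> -> ->]].
    by exists o0.
  - by case/allpairsP => -[s' d] /= [_]; rewrite mem_filter => /andP[Rd _] [-> -> -> -> ->]; split=> //; exists d.
case: x => [[]|p]; case: y => [[]|q] //=.
- case=> -> -> [d Rd ->]; apply/or3P; apply: Or31; apply/allpairsP; exists (s, d).
  by rewrite /= mem_enum mem_filter mem_enum Rd.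
- case=> -> -> [d Rd ->]; apply/or3P; apply: Or33; apply/allpairsP; exists (s, d).
  by rewrite /= mem_enum mem_filter mem_enum Rd.
- case=> o0 st Ro; apply/or3P; apply: Or32; apply/flattenP.
  exists [seq (inr p, s, inr q, o', e) | o' <- relabellings o0].
    by apply/mapP; exists (p, s, q, o0, e).
  by apply/mapP; exists o => //; apply/relabellingsP.
Qed.

Lemma relabel_table_final s y o e : ~ tab_step relabel_table (inl false) s y o e.
Proof. by move/relabel_tableP; case: y => [[]|?]. Qed.

(** The run is taken from after the initial step; its last step, into [inl false], accounts for the
    image of [RM]. *)
Lemma relabel_sound S c tr c' : srun relabel_step S c tr c' -> c'.1 = inl false ->
  forall p, c.1 = inr p -> exists tr0 i, [/\ 0 < i <= size S, srun (tab_step tab) S (p, c.2) tr0 (nf, i)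
    & all2 R (map (@Sy C) (outs tr0) ++ [:: RM]) (outs tr)].
Proof.
elim=> {c tr c'} [c -> //|x i y o e tr c ib st r IH] Ec p /= Ex.
rewrite {}Ex in st; case: y st r IH => [[]|q] //= st r IH.
  case: st => -> _ [d Rd ->]; exists [::], i; split=> //; first exact: srun0.
  inversion r as [|? ? ? ? ? ? ? ? st']; subst => //.
  by rewrite /outs /= Rd.
case: st => o0 st Ro; have [tr0 [l [lb r0 R0]]] := IH Ec q erefl.
exists ((p, i, o0) :: tr0), l; split=> //; first exact: srunS st r0.
by rewrite /outs /= map_cat -catA; apply: all2_cat_id.
Qed.

Lemma relabel_complete S c tr0 c' : srun (tab_step tab) S c tr0 c' -> c'.1 = nf -> 0 < c'.2 <= size S ->
  forall v, all2 R (map (@Sy C) (outs tr0) ++ [:: RM]) v ->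
  exists2 tr, srun relabel_step S (inr c.1, c.2) tr (inl false, c'.2) & outs tr = v.
Proof.
elim=> {c tr0 c'} [[p i] /= Ep ib [//|d []]|p i q o e tr c ib st r IH Ec cb v] /=.
  rewrite andbT => Rd; exists [:: (inr p, i, [:: d])] => //.
  apply: (srunS (e := Stay)) (srun0 ) => //.
  by split=> //; exists d.
by move=> d' l; rewrite andbF.
rewrite /outs /= map_cat -catA => /all2_catP[v1 [v2 [-> R1 R2]]].
have [tr' r' E'] := IH Ec cb v2 R2.
exists ((inr p, i, v1) :: tr'); last by rewrite /outs /=; congr cat.
by apply: srunS r' => //; exists o.
Qed.

Lemma relabel_accepts w v : (exists2 tr, accepts (tab_step relabel_table) (inl true) (inl false) (marked w) tr
    & outs tr = v) <->
  exists2 tr, accepts (tab_step tab) n0 nf (marked w) tr & relabel R (marked (outs tr)) v.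
Proof.
split=> [[tr a <-]|[tr [i ib r]]].
  have [i ib r] : accepts relabel_step (inl true) (inl false) (marked w) tr.
    by apply: eq_accepts a => *; apply/relabel_tableP.
  inversion r as [|? ? y o e tr' ? lb st r']; subst.
  case: y st r' => [[]|q] //= [-> -> [d Rd ->]] r'.
  have [tr0 [l [lb' r0 R0]]] := relabel_sound r' erefl erefl.
  exists tr0; first by exists l.
  by rewrite /relabel /marked /outs /= Rd.
rewrite /relabel /marked; case: v => // d v /= /andP[Rd Rv].
have [tr' r' E'] := relabel_complete r erefl ib Rv.
exists ((inl true, 1, [:: d]) :: tr'); last by rewrite /outs /= -E'.
apply: (@eq_accepts _ _ _ relabel_step); first by move=> *; apply/relabel_tableP.
exists i => //; apply: (srunS (e := Stay)) r' => //.
by split=> //; exists d.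
Qed.

End Relabel.

(** * The identity machine and the induction on the number of factors *)

Definition copy_delta (C : finType) (st : bool) (s : sym C) : option (bool * seq C * dir) :=
  if st then match s with
    | LM => Some (true, [::], Rgt)
    | RM => Some (false, [::], Stay)
    | Sy c => Some (true, [:: c], Rgt)
    end
  else None.

(** By determinism it suffices to exhibit one accepting run with output [u]. *)
Lemma copy_accepts (C : finType) (u v : seq C) :
  (exists2 tr, accepts (table_step (@copy_delta C)) true false (marked u) tr & outs tr = v) <-> u = v.
Proof.
suff [tr0 a0 E0] : exists2 tr,
    accepts (table_step (@copy_delta C)) true false (marked u) tr & outs tr = u.
  split=> [[tr a <-]|<-]; last by exists tr0.
  rewrite -{1}E0 (accepts_uniq _ _ a0 a) // => p s q o e q' o' e'.
  by rewrite /table_step => -> [-> -> ->].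
have runs x v' : exists2 tr, srun (table_step (@copy_delta C)) (x ++ map (@Sy C) v' ++ [:: RM])
    (true, (size x).+1) tr (false, size (x ++ map (@Sy C) v' ++ [:: RM])) & outs tr = v'.
  elim: v' x => [|c v' IH] x.
    exists [:: (true, (size x).+1, [::])] => //.
    rewrite /= size_cat addn1; apply: (srunS (e := Stay)) (srun0 ).
      by rewrite size_cat addn1 ltnS leqnn.
    by rewrite /table_step -addn1 cell_catr.
  have [tr r E] := IH (rcons x (Sy c)); rewrite cat_rcons size_rcons in r.
  exists ((true, (size x).+1, [:: c]) :: tr); last by rewrite /outs /= -E.
  apply: (srunS (e := Rgt)) r; first by rewrite size_cat /=; lia.
  by rewrite /table_step -addn1 cell_catr.
have [tr r E] := runs [:: LM] u.
exists ((true, 1, [::]) :: tr) => //; exists (size (marked u)); first by rewrite size_marked leqnn.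
by apply: (srunS (e := Rgt)) r.
Qed.

Lemma eq_MREL_DGSM_on_finite (A B : finType) (m m' : transduction A B) :
  (forall w z, m w z <-> m' w z) -> MREL_DGSM_on_finite m -> MREL_DGSM_on_finite m'.
Proof.
move=> E [f [ff fm mf]]; exists f; split=> // [w z /fm/E //|w K bnd z /E].
by apply: (mf w K) => z' /E; exact: bnd.
Qed.

(** A single machine is followed by the identity machine, so that [composed_tables] applies. *)
Lemma NGSM_on_finite (A B : finType) (m : transduction A B) :
  in_NGSM m -> MREL_DGSM_on_finite m.
Proof.
case=> M mE.
have tabf s q o e : ~ tab_step (gsm_table M) (gqf M) s q o e by move/gsm_tableP/gsm_step_final.
have := @composed_tables _ _ _ _ _ _ (gqin M) _ (@copy_delta B) true false tabf (fun=> erefl).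
apply: eq_MREL_DGSM_on_finite.
move=> w z; rewrite mE realized_table; split=> [[tr [trd [a ad <-]]]|[tr a <-]].
  by exists tr => //; apply/copy_accepts; exists trd.
have [trd ad E] := (copy_accepts (outs tr) (outs tr)).2 erefl.
by exists tr, trd.
Qed.

(** The relabelling in the approximation [f] of [m2] is absorbed into the first machine. Where the
    outputs of [comp m1 m2] on [w] are bounded by [K], so are those of [m2] on each image of [w]
    under [m1], and there [f] agrees with [m2]. *)
Lemma NGSM_comp_on_finite (A B C : finType) (m1 : transduction A C) (m2 : transduction C B) :
  in_NGSM m1 -> MREL_DGSM_on_finite m2 -> MREL_DGSM_on_finite (comp m1 m2).
Proof.
case=> M mE [f [[D [r [g [[R rE] [[M2 [det gE]] fE]]]]] fm mf]].
have cE w z : composed (tab_step (relabel_table (gsm_table M) (gqin M) (gqf M) R)) (inl true) (inl false)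
    (table_step (@gsm_delta _ _ M2)) (gqin M2) (gqf M2) w z <-> comp m1 f w z.
  split=> [[tr [trd [a ad Ez]]]|[u [/mE/realized_table[tr a <-] /fE[y [/rE Ry /gE]]]]].
    have [|tr0 a0 Rv] := (relabel_accepts (gsm_table M) (gqin M) (gqf M) R w (outs tr)).1; first by exists tr.
    exists (outs tr0); split; first by apply/mE/realized_table; exists tr0.
    apply/fE; exists (outs tr); split; first exact/rE.
    by apply/gE/(realized_delta _ _ det); exists trd.
  case/(realized_delta _ _ det) => trd ad <-.
  have [|tr2 a2 E2] := (relabel_accepts (gsm_table M) (gqin M) (gqf M) R w y).2; first by exists tr.
  by exists tr2, trd; rewrite E2.
have [f' [ff fc cf]] := eq_MREL_DGSM_on_finite cE
  (composed_tables _ _ (@relabel_table_final _ _ _ _ _ _ _ R) (gsm_delta_final det)).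
exists f'; split=> // [w z /fc[u [m1u /fm m2u]]|w K bnd z [u [m1u m2u]]]; first by exists u.
apply: (cf w K) => [z' [u' [m1u' /fm m2u']]|]; first by apply: bnd; exists u'.
exists u; split=> //; apply: (mf u K) => // z' m2z'; by apply: bnd; exists u.
Qed.

Lemma NGSMk_on_finite k (A B : finType) (m : transduction A B) :
  in_NGSMk k m -> MREL_DGSM_on_finite m.
Proof.
elim: k A B m => [|k IH] A B m /=; first exact: NGSM_on_finite.
case=> C [m1 [m2 [m1n [/IH m2f mE]]]].
by apply: eq_MREL_DGSM_on_finite (NGSM_comp_on_finite m1n m2f) => w z; rewrite mE.
Qed.

Theorem theorem6p9 (A B : finType) (m : transduction A B) (k : nat) :
  1 <= k -> in_NGSM_pow k m -> finitary m -> in_MREL_DGSM m.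
Proof.
move=> _ /NGSMk_on_finite[f [[D [m1 [m2 [m1r [m2d fE]]]]] fm mf]] fin.
exists D, m1, m2; split=> //; split=> // w z; rewrite -fE; split=> [mz|/fm //].
have [|s sP] := fin w; first by exists z.
(* The sum of the lengths of the listed outputs bounds each of them. *)
apply: (mf w (sumn (map size s))) => // z' /sP.
by elim: s {sP} => //= x s IH [->|/IH]; lia.
Qed.
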